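(* Let $\Gamma$ be a hyperbolic group, and let $\mu$ be a finitely supported, admissible, symmetric probability measure on $\Gamma$. Then there exists an equivariant, surjective, continuous map from the $0$-Martin compactification $\Delta_{M,0}\Gamma$ to the Gromov compactification $\Delta\Gamma$ which extends the identity on $\Gamma$. However, this map may fail to be injective in general; that is, there exist a hyperbolic group $\Gamma$ and a finitely supported, admissible, symmetric probability measure $\mu$ on $\Gamma$ for which this map is not injective.
   Context: $e$ is the identity of $\Gamma$, $P(x,y)=\mu(x^{-1}y)$, and $P^n(x,y)=\mu^{*n}(x^{-1}y)$ (with $P^0(x,y)=\delta_{x,y}$). $\mu$ is admissible if its support generates $\Gamma$ as a semigroup, and symmetric if $\mu(x)=\mu(x^{-1})$ for all $x$. $\mu$ is not assumed to satisfy $\mu(e)>0$. Let $|x|=\inf\{n\ge0: P^n(e,x)>0\}$, the word norm for the generating set $\operatorname{supp}\mu$. Elements $e,x,y$ are aligned in this order on a geodesic if $|y|=|x|+|x^{-1}y|$. The $0$-Martin kernel is $K(x,y\,|\,0)=P^{|y|-|x|}(x,y)/P^{|y|}(e,y)$ if $e,x,y$ are aligned in this order on a geodesic, and $K(x,y\,|\,0)=0$ otherwise. The $0$-Martin compactification $\Delta_{M,0}\Gamma$ is the smallest compactification of $\Gamma$ (compact Hausdorff, containing $\Gamma$ as a discrete, open, dense subset) to which all functions $y\mapsto K(x,y\,|\,0)$, $x\in\Gamma$, extend continuously. The Gromov compactification $\Delta\Gamma$ is the union of $\Gamma$ and its Gromov boundary. Equivariance refers to the left multiplication action of $\Gamma$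 on itself and its extension to the two compactifications.
   Formalization: Left multiplication need not extend continuously to the 0-Martin compactification, so ''equivariant'' is read as: whenever (p,q) lies in the closure of the graph {(x,gx)}, q maps to g times the image of p; this gives usual equivariance for any continuous extension. *)

(* Defs.v *)
From HB Require Import structures.
From mathcomp Require Import all_boot all_order all_algebra.
From mathcomp Require Import all_classical all_reals all_analysis.
From mathcomp Require Import lra.

Set Implicit Arguments.
Unset Strict Implicit.
Unset Printing Implicit Defensive.

Import Order.TTheory GRing.Theory Num.Theory.
Import numFieldNormedType.Exports.

Local Open Scope classical_set_scope.
Local Open Scope ring_scope.

(* Infimum of a set of natural numbers; 0 on the empty set. *)
Definition ninf (A : set nat) : nat :=
  if pselect (exists n, `[< A n >]) is left h then ex_minn h else 0%N.

Section WordMetric.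
Variable G : groupType.
Local Open Scope group_scope.

Definition word_in (S : set G) (s : seq G) : Prop :=
  forall y, y \in s -> S y \/ S y^-1.

Record genset := Genset {
  gens :> set G ;
  gens_finite : finite_set gens ;
  gens_gen : forall x, exists2 s : seq G, word_in gens s & \prod_(y <- s) y = x }.

Variable S : genset.

Definition word_len (x : G) : nat :=
  ninf [set n | exists s : seq G,
    [/\ size s = n, word_in S s & \prod_(y <- s) y = x]].

Definition word_dist (x y : G) : nat := word_len (x^-1 * y).

Definition gprod (w x y : G) : rat :=
  (((word_dist w x)%:R + (word_dist w y)%:R - (word_dist x y)%:R) / 2%:R)%R.

Definition hyperbolic : Prop := exists delta : rat, forall w x y z : G,
  (Num.min (gprod w x y) (gprod w y z) - delta <= gprod w x z)%R.

(* liminf_(i,j) (u_i | v_j)_e >= r: the Gromov product takes values in (1/2)N,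
   so (for r in (1/2)N) the inequality holds eventually. *)
Definition gprod_ge (r : rat) (u v : nat -> G) : Prop :=
  exists N, forall i j, (N <= i)%N -> (N <= j)%N -> (r <= gprod 1 (u i) (v j))%R.

Definition gromov_seq (u : nat -> G) : Prop := forall r, gprod_ge r u u.

Definition gromov_equiv (u v : nat -> G) : Prop := forall r, gprod_ge r u v.

Definition bdry_class (u : nat -> G) : set (nat -> G) :=
  [set v | gromov_seq v /\ gromov_equiv u v].

Definition gromov_bdry :=
  {c : set (nat -> G) | exists2 u, gromov_seq u & c = bdry_class u}.

Inductive gromov_cpt : Type := GIn of G | GBd of gromov_bdry.

HB.instance Definition _ := gen_eqMixin gromov_cpt.
HB.instance Definition _ := gen_choiceMixin gromov_cpt.

Definition represents (u : nat -> G) (p : gromov_cpt) : Prop :=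
  match p with
  | GIn x => forall n, u n = x
  | GBd c => sval c u
  end.

Definition gromov_near (r : rat) (p q : gromov_cpt) : Prop :=
  exists u v, [/\ represents u p, represents v q & gprod_ge r u v].

(* Points of the group are isolated, and the sets
   [set q | gromov_near r (GBd c) q] form a neighbourhood basis at c. *)
Definition gromov_open (U : set gromov_cpt) : Prop :=
  forall c, U (GBd c) -> exists r, forall q, gromov_near r (GBd c) q -> U q.

Lemma gprod_ge_le r r' u v : (r <= r')%R -> gprod_ge r' u v -> gprod_ge r u v.
Proof.
move=> rr' [N hN]; exists N => i j Ni Nj; exact: le_trans (hN _ _ Ni Nj).
Qed.

Lemma gromov_openT : gromov_open setT.
Proof. by move=> c _; exists 0%R. Qed.

Lemma gromov_openI : setI_closed gromov_open.
Proof.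
move=> A B oA oB c [/oA[r hr] /oB[r' hr']]; exists (Num.max r r') => q [u [v [up vq h]]].
split; [apply: hr | apply: hr']; exists u, v; split=> //; apply: gprod_ge_le h.
  by rewrite le_max lexx.
by rewrite le_max lexx orbT.
Qed.

Lemma gromov_open_bigU (I : Type) (f : I -> set gromov_cpt) :
  (forall i, gromov_open (f i)) -> gromov_open (\bigcup_i f i).
Proof.
move=> of_ c [i _ /of_[r hr]]; exists r => q /hr fq; by exists i.
Qed.

HB.instance Definition _ := @isOpenTopological.Build gromov_cpt
  gromov_open gromov_openT gromov_openI gromov_open_bigU.

Lemma ninf_le (A : set nat) n : A n -> (ninf A <= n)%N.
Proof.
move=> An; rewrite /ninf; case: pselect => // h.
by case: ex_minnP => m _; apply; apply/asboolP.
Qed.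

Lemma ninf_in (A : set nat) n : A n -> A (ninf A).
Proof.
move=> An; rewrite /ninf; case: pselect => [h|[]].
  by case: ex_minnP => m /asboolP.
by exists n; apply/asboolP.
Qed.

Lemma word_lenM x y : (word_len (x * y) <= word_len x + word_len y)%N.
Proof.
have [s [sx ss xE]] : [set n | exists s : seq G,
    [/\ size s = n, word_in S s & \prod_(y <- s) y = x]] (word_len x).
  by have [s ss sE] := gens_gen S x; apply: (@ninf_in _ (size s)); exists s.
have [t [ty tt yE]] : [set n | exists s : seq G,
    [/\ size s = n, word_in S s & \prod_(z <- s) z = y]] (word_len y).
  by have [t tt tE] := gens_gen S y; apply: (@ninf_in _ (size t)); exists t.
apply: ninf_le; exists (s ++ t); split; first by rewrite size_cat sx ty.
  by move=> z; rewrite mem_cat => /orP[/ss|/tt].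
by rewrite big_cat xE yE.
Qed.

Lemma gprod_shift (g x y : G) :
  (gprod 1 x y - (word_len g^-1)%:R <= gprod 1 (g * x) (g * y))%R.
Proof.
rewrite /gprod /word_dist !invg1 !mul1g invgM -mulgA mulKg.
have h z : (((word_len z)%:R : rat) <= (word_len g^-1)%:R + (word_len (g * z))%:R)%R.
  by rewrite -natrD ler_nat; have := word_lenM g^-1 (g * z); rewrite mulKg.
have := h x; have := h y.
set a := (word_len x)%:R%R; set b := (word_len y)%:R%R; set k := (word_len g^-1)%:R%R.
set c := (word_len (g * x))%:R%R; set d := (word_len (g * y))%:R%R.
set e := (word_len (x^-1 * y))%:R%R => h1 h2.
lra.
Qed.

Lemma gprod_ge_shift g u v : (forall r, gprod_ge r u v) ->
  forall r, gprod_ge r (fun n => g * u n) (fun n => g * v n).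
Proof.
move=> h r; have [N hN] := h (r + (word_len g^-1)%:R)%R.
exists N => i j Ni Nj; apply: le_trans (gprod_shift _ _ _).
by rewrite lerBrDr hN.
Qed.

Lemma gprod_ge_unshift g u v :
  (forall r, gprod_ge r (fun n => g * u n) (fun n => g * v n)) ->
  forall r, gprod_ge r u v.
Proof.
move=> h r; have [N hN] := gprod_ge_shift g^-1 h r.
by exists N => i j Ni Nj; have := hN _ _ Ni Nj; rewrite !mulKg.
Qed.

Lemma bdry_act_subproof (g : G) (c : gromov_bdry) :
  exists2 u, gromov_seq u &
    [set v | sval c (fun n => g^-1 * v n)] = bdry_class u.
Proof.
case: c => _ /= [u ugr ->]; exists (fun n => g * u n); first exact: gprod_ge_shift.
have VK (v : nat -> G) : v = (fun n => g * (g^-1 * v n)).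
  by apply/funext => n; rewrite mulVKg.
apply/seteqP; split=> v [vgr uv]; split.
- by rewrite (VK v); exact: gprod_ge_shift.
- by rewrite (VK v); exact: gprod_ge_shift.
- by apply: (@gprod_ge_unshift g); rewrite -VK.
- by apply: (@gprod_ge_unshift g); rewrite -VK.
Qed.

Definition bdry_act (g : G) (c : gromov_bdry) : gromov_bdry :=
  exist _ _ (bdry_act_subproof g c).

(* g.[(u_n)] = [(g u_n)]. *)
Definition gromov_act (g : G) (p : gromov_cpt) : gromov_cpt :=
  match p with
  | GIn x => GIn (g * x)
  | GBd c => GBd (bdry_act g c)
  end.

End WordMetric.

Section RandomWalk.
Variables (R : realType) (G : groupType) (mu : G -> R).
Local Open Scope group_scope.

Definition prob_measure : Prop :=
  (forall x, 0 <= mu x)%R /\ (\sum_(x \in [set: G]) mu x = 1)%R.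

Definition msupp : set G := [set x | (0 < mu x)%R].

Definition admissible : Prop := forall x : G, exists s : seq G,
  [/\ s != [::], forall y, y \in s -> msupp y & \prod_(y <- s) y = x].

Definition symmetric_measure : Prop := forall x : G, mu x = mu x^-1.

Fixpoint conv_pow (n : nat) (x : G) : R :=
  if n is m.+1 then (\sum_(y \in [set: G]) mu y * conv_pow m (y^-1 * x))%R
  else if x == 1 then 1%R else 0%R.

Definition trans_prob (n : nat) (x y : G) : R := conv_pow n (x^-1 * y).

Definition mu_len (x : G) : nat := ninf [set n | (0 < trans_prob n 1 x)%R].

Definition martin_kernel0 (x y : G) : R :=
  if mu_len y == (mu_len x + mu_len (x^-1 * y))%N then
    (trans_prob (mu_len y - mu_len x) x y / trans_prob (mu_len y) 1 y)%R
  else 0%R.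

(* Compact Hausdorff space containing G as a discrete, open, dense subset. *)
Definition compactification (X : topologicalType) (i : G -> X) : Prop :=
  [/\ compact [set: X], hausdorff_space X, injective i,
      (forall x, open [set i x]) & dense (range i)].

Definition martin0_extends (X : topologicalType) (i : G -> X) : Prop :=
  forall x, exists2 k : X -> R, continuous k & forall y, k (i y) = martin_kernel0 x y.

Definition martin0_compactification (X : topologicalType) (i : G -> X) : Prop :=
  [/\ compactification i, martin0_extends i &
      forall (Y : topologicalType) (j : G -> Y),
        compactification j -> martin0_extends j ->
        exists2 h : Y -> X, continuous h & forall y, h (j y) = i y].

End RandomWalk.

(* The extension of left multiplication by g to a compactification i : G -> X,
   as a relation: the closure in X * X of its graph on G. It contains the graph
   of any continuous self-map of X extending left multiplication by g, and is
   equal to it when there is one and X is compact Hausdorff; on the 0-Martin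
   compactification there need not be one. *)
Definition left_mul_ext (G : groupType) (X : topologicalType) (i : G -> X)
    (g : G) (p q : X) : Prop :=
  closure [set (i x, i (g * x)%g) | x in [set: G]] (p, q).

Definition equivariant_to_gromov (G : groupType) (S : genset G)
    (X : topologicalType) (i : G -> X) (f : X -> gromov_cpt S) : Prop :=
  forall g p q, left_mul_ext i g p q -> f q = gromov_act g (f p).

(* The equivariant surjective continuous maps X -> gromov_cpt S extending the
   identity of G; there is at most one as G is dense in X. *)
Definition gromov_projection (G : groupType) (S : genset G)
    (X : topologicalType) (i : G -> X) (f : X -> gromov_cpt S) : Prop :=
  [/\ equivariant_to_gromov i f, (forall q, exists p, f p = q), continuous f &
      forall x, f (i x) = GIn S x].

(* Main.v *)
Require Import Defs.
From HB Require Import structures.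
From mathcomp Require Import all_boot all_order all_algebra finmap.
From mathcomp Require Import all_classical all_reals all_analysis.
From mathcomp Require Import zify lra.

Set Implicit Arguments.
Unset Strict Implicit.
Unset Printing Implicit Defensive.

Import Order.TTheory GRing.Theory Num.Theory.
Import numFieldNormedType.Exports.

Local Open Scope classical_set_scope.
Local Open Scope ring_scope.

(**
The map exists because the supports of the 0-Martin kernels record geodesics.
K(x, y) is positive exactly when x lies on a geodesic from e to y for the word
norm of supp mu, and it is bounded by 1 / P^|x|(e, x), so the kernels and the
indicators of points embed the group in a compact product; the closure of the
image is the 0-Martin compactification ([martin0_model]).

P^(n+1)(e, y) is a mu-average of the numbers P^n(z, y), hence at most one of
them. Iterating, every y of norm at least k has a predecessor x of norm k with
K(x, y) >= 1 ([kernel_ge1_ex]). There are finitely many x of norm k, so the same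
holds in the limit: a point p at infinity has, for each k, some x_k of norm k
whose extended kernel is positive at p, i.e. which lies on a geodesic from e to
every y close to p ([precedes_ex]). The projection maps p to the Gromov boundary
point of the sequence (x_k).

That (x_k) is a Gromov sequence, that its class depends on p only, and that the
map is continuous, surjective and equivariant, all come from one estimate: if x
is on a mu-geodesic from e to y, then the Gromov product (x | y)_e in the given
metric is bounded below by a function of |x| that tends to infinity
([gprod_aligned_ge], [mu_aligned_gprod_ge]). The given metric need not be that of
supp mu, so this is a weak form of the stability of quasi-geodesics. It is proved
with Gromov products only. A path of 2^k steps comes within O(k) of every point
of the geodesic joining its ends; so for a quasi-geodesic p of length at most 2^k
all the products (p_0 | p_N)_(p_a) are O(k) ([gprod_geodesic_log]). Applied at the
times 2^m, 2^(m+1), ... of one quasi-geodesic this costs O(m) against the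
distance to p_0, which is of order 2^m ([gprod_geodesic_growth]).

For the failure of injectivity take (Z/2 * Z/2 * Z/2) x Z/2, where the involutions
p, q, r generate the free product and t the central factor, and mu uniform on {p, q, r, rt}. Let a_n be the
alternating word p q p ... of length n. The elements r a_n and r a_n t are at
bounded distance from each other, so they converge to the same Gromov boundary
point. But a letter r or rt is the only place where t can be acquired for free,
so a geodesic to r a_n must start with r and a geodesic to r a_n t with rt
([fray_first_step]): the kernel of r separates the limits in the 0-Martin
compactification ([fray_not_injective]). *)

(** * Word metrics, geodesics and Gromov products *)

Section GeodesicWord.
Variables (G : groupType) (len : G -> nat).
Local Open Scope group_scope.
Hypothesis len1 : len 1 = 0%N.
Hypothesis lenM : forall x y, (len (x * y) <= len x + len y)%N.

Lemma len_prod (s : seq G) : (forall z, z \in s -> (len z <= 1)%N) ->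
  (len (\prod_(z <- s) z) <= size s)%N.
Proof.
elim: s => [|a s IH] hs; first by rewrite big_nil len1.
rewrite big_cons /= -add1n (leq_trans (lenM _ _))// leq_add ?hs ?mem_head// IH// => z zs.
by rewrite hs// inE zs orbT.
Qed.

Definition prefix_prod (s : seq G) (n : nat) : G := \prod_(z <- take n s) z.

(** A word as long as the norm of its product spells a geodesic: a shorter path
between two of its prefixes would shorten the whole product. It is applied both
to the word norm of a generating set and to that of the support of mu. *)
Lemma geodesic_of_word (s : seq G) : (forall z, z \in s -> (len z <= 1)%N) ->
  len (\prod_(z <- s) z) = size s ->
  forall i j, (i <= j <= size s)%N ->
  len ((prefix_prod s i)^-1 * prefix_prod s j) = (j - i)%N.
Proof.
move=> hs hlen i j /andP[ij js].
have sub (t : seq G) : (forall z, z \in t -> z \in s) -> (len (\prod_(z <- t) z) <= size t)%N.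
  by move=> ht; apply: len_prod => z /ht /hs.
have h1 := sub (take i s) (fun z => @mem_take _ _ _ z).
have h2 := sub (take (j - i) (drop i s))
  (fun z h => mem_drop (mem_take h)).
have h3 := sub (drop j s) (fun z => @mem_drop _ _ _ z).
have takeE : take j s = take i s ++ take (j - i) (drop i s).
  by rewrite -{1}(subnKC ij) takeD.
have -> : (prefix_prod s i)^-1 * prefix_prod s j
    = \prod_(z <- take (j - i) (drop i s)) z.
  by rewrite /prefix_prod takeE big_cat mulKg.
have := hlen; rewrite -{1}(cat_take_drop j s) takeE !big_cat /= -mulgA => hl.
have := lenM (\prod_(z <- take i s) z)
  ((\prod_(z <- take (j - i) (drop i s)) z) * \prod_(z <- drop j s) z).
rewrite hl; have := lenM (\prod_(z <- take (j - i) (drop i s)) z)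
  (\prod_(z <- drop j s) z).
move: h1 h2 h3; rewrite size_drop !size_takel ?size_drop ?leq_sub2r ?(leq_trans ij)//.
move: ij js; clear; move: (size s) (len _) (len _) (len _) (len _) => /=; lia.
Qed.

End GeodesicWord.

Section WordMetric.
Variables (G : groupType) (S : genset G).
Local Open Scope group_scope.
Local Notation wl := (word_len S).
Local Notation d := (word_dist S).

Lemma word_lenP x : exists s : seq G,
  [/\ size s = wl x, word_in S s & \prod_(y <- s) y = x].
Proof.
have [s ss sE] := gens_gen S x.
exact: (@ninf_in [set n | exists s : seq G,
  [/\ size s = n, word_in S s & \prod_(y <- s) y = x]] (size s)
  (ex_intro _ s (And3 erefl ss sE))).
Qed.

Lemma word_len_le s : word_in S s -> (wl (\prod_(y <- s) y) <= size s)%N.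
Proof. by move=> ss; apply: ninf_le; exists s. Qed.

Lemma word_len1 : wl 1 = 0%N.
Proof.
have /(_ _)/wrap[//|] := @word_len_le [::]; by rewrite big_nil leqn0 => /eqP.
Qed.

Lemma word_len_letter z : gens S z \/ gens S z^-1 -> (wl z <= 1)%N.
Proof.
move=> Sz; have /(_ _)/wrap[|] := @word_len_le [:: z]; last by rewrite big_seq1.
by move=> y; rewrite inE => /eqP ->.
Qed.

Lemma word_lenV_le x : (wl x^-1 <= wl x)%N.
Proof.
have [s [<- ss <-]] := word_lenP x.
suff [t [<- tS <-]] : exists t : seq G,
    [/\ size t = size s, word_in S t & \prod_(y <- t) y = (\prod_(y <- s) y)^-1].
  exact: word_len_le.
elim: s ss => [|a s IH] ss; first by exists [::]; split => //; rewrite !big_nil invg1.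
have [|t [tsz tS tE]] := IH.
  by move=> y ys; apply: ss; rewrite inE ys orbT.
exists (rcons t a^-1); split; first by rewrite size_rcons tsz.
  move=> y; rewrite mem_rcons inE => /orP[/eqP ->|/tS//].
  by rewrite invgK; have [] := ss a (mem_head _ _); [right|left].
by rewrite -cats1 big_cat big_seq1 big_cons /= tE invgM.
Qed.

Lemma word_lenV x : wl x^-1 = wl x.
Proof. by apply/eqP; rewrite eqn_leq word_lenV_le -{1}(invgK x) word_lenV_le. Qed.

Lemma word_distC x y : d x y = d y x.
Proof. by rewrite /word_dist -word_lenV invgM invgK. Qed.

Lemma word_dist_tri y x z : (d x z <= d x y + d y z)%N.
Proof.
by rewrite /word_dist (_ : x^-1 * z = (x^-1 * y) * (y^-1 * z)) ?word_lenM// -mulgA mulVKg.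
Qed.

Lemma word_distxx x : d x x = 0%N.
Proof. by rewrite /word_dist mulVg word_len1. Qed.

Lemma word_dist1 x : d 1 x = wl x.
Proof. by rewrite /word_dist invg1 mul1g. Qed.

Local Open Scope ring_scope.
Local Notation dQ x y := ((d x y)%:R : rat).

Lemma distQ_tri y x z : dQ x z <= dQ x y + dQ y z.
Proof. by rewrite -natrD ler_nat word_dist_tri. Qed.

Lemma gprodC w x y : gprod S w x y = gprod S w y x.
Proof. by rewrite /gprod (word_distC x y) [_%:R + _]addrC. Qed.

Lemma gprod_base_le v w x y : gprod S v x y <= gprod S w x y + dQ v w.
Proof.
rewrite /gprod; have := distQ_tri w v x; have := distQ_tri w v y; lra.
Qed.

Lemma gprod_ge_dist w x y : dQ w x - dQ x y <= gprod S w x y.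
Proof.
rewrite /gprod; have := distQ_tri y w x; rewrite (word_distC y x); lra.
Qed.

(** (x | y)_w and (w | y)_x add up to the distance of w and x, so bounding one
from above bounds the other from below. *)
Lemma gprod_swap w x y : gprod S w x y = dQ w x - gprod S x w y.
Proof. rewrite /gprod (word_distC x w); lra. Qed.

Lemma word_geodesic x y : exists w : nat -> G,
  [/\ w 0%N = x, w (d x y) = y &
   forall i j, (i <= j <= d x y)%N -> d (w i) (w j) = (j - i)%N].
Proof.
have [s [ssz sS sE]] := word_lenP (x^-1 * y)%g.
exists (fun n => (x * prefix_prod s n)%g); split.
- by rewrite /prefix_prod take0 big_nil mulg1.
- by rewrite /prefix_prod /word_dist -ssz take_size sE mulVKg.
- move=> i j ij; rewrite /word_dist invgM -mulgA mulKg.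
  apply: (geodesic_of_word word_len1 (@word_lenM _ S)) => [z /sS||].
  + exact: word_len_letter.
  + by rewrite sE ssz.
  + by rewrite ssz.
Qed.

End WordMetric.

(** * Gromov products along quasi-geodesics *)

Lemma sqr_le_expn2 m : (m * m <= 3 * 2 ^ m)%N.
Proof.
elim: m => // m IH; have := ltn_expl m (isT : (1 < 2)%N).
by rewrite expnS; nia.
Qed.

(** Used to absorb the O(m) losses at time 2^m into an additive constant. *)
Lemma linear_le_expn2 (B : rat) : exists K : rat, forall m : nat, B * m%:R <= (2 ^ m)%:R + K.
Proof.
(* m^2 / 3 - B m + 3 B^2 / 4 is a nonnegative multiple of (2 m - 3 B)^2 *)
exists (3%:R * B * B / 4%:R) => m.
have : (m%:R * m%:R : rat) <= 3%:R * (2 ^ m)%:R by rewrite -!natrM ler_nat sqr_le_expn2.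
set M : rat := m%:R; set E : rat := (2 ^ m)%:R => h.
have := sqr_ge0 (2%:R * M - 3%:R * B); rewrite expr2; nra.
Qed.

Section QuasiGeodesic.
Variables (G : groupType) (S : genset G) (delta : rat).
Hypothesis delta_ge1 : 1 <= delta.
Hypothesis hypS : forall w x y z : G,
  Num.min (gprod S w x y) (gprod S w y z) - delta <= gprod S w x z.
Local Notation wl := (word_len S).
Local Notation d := (word_dist S).
Local Notation dQ x y := ((d x y)%:R : rat).

(** The hyperbolic inequality, used along a binary tree over the 2^k steps, loses
delta once per level. *)
Lemma gprod_chain w (p : nat -> G) r k a :
  (forall i, (a <= i < a + 2 ^ k)%N -> r <= gprod S w (p i) (p i.+1)) ->
  r - k%:R * delta <= gprod S w (p a) (p (a + 2 ^ k)%N).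
Proof.
elim: k a => [|k IH] a hr.
  by rewrite mul0r subr0 addn1 hr// leqnn addn1 ltnSn.
have h1 : r - k%:R * delta <= gprod S w (p a) (p (a + 2 ^ k)%N).
  by apply: IH => i /andP[ai ia]; apply: hr; rewrite ai expnS; lia.
have h2 : r - k%:R * delta <= gprod S w (p (a + 2 ^ k)%N) (p (a + 2 ^ k + 2 ^ k)%N).
  by apply: IH => i /andP[ai ia]; apply: hr; rewrite expnS; lia.
have := hypS w (p a) (p (a + 2 ^ k)%N) (p (a + 2 ^ k + 2 ^ k)%N).
rewrite expnS mul2n -addnn addnA.
have : r - k%:R * delta <= Num.min (gprod S w (p a) (p (a + 2 ^ k)%N))
   (gprod S w (p (a + 2 ^ k)%N) (p (a + 2 ^ k + 2 ^ k)%N)) by rewrite le_min h1.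
rewrite -[k.+1]addn1 natrD; lra.
Qed.

(** If all points of the path were far from w, then all products of consecutive
points based at w would be large, hence also the product of the two ends by
[gprod_chain]; but the latter vanishes when w is on a geodesic between them. *)
Lemma path_near_geodesic (L : nat) w (p : nat -> G) N k : (N <= 2 ^ k)%N ->
  (forall i, (i < N)%N -> (d (p i) (p i.+1) <= L)%N) ->
  gprod S w (p 0%N) (p N) = 0 ->
  exists2 i, (i <= N)%N & dQ w (p i) <= k%:R * delta + L%:R + 1.
Proof.
move=> Nk pL w0; apply: contrapT => far.
have {}far i : (i <= N)%N -> k%:R * delta + L%:R + 1 < dQ w (p i).
  by move=> iN; rewrite ltNge; apply/negP => h; apply: far; exists i.
(* the path is stopped at p N to make its length a power of 2 *)
pose q i := p (minn i N).
have := @gprod_chain w q (k%:R * delta + 1) k 0%N.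
rewrite /q min0n add0n (minn_idPr Nk) w0 => /(_ _)/wrap[i _|]; last by lra.
apply: le_trans (gprod_ge_dist _ _ _ _).
have := far (minn i N) (geq_minr _ _).
have : dQ (p (minn i N)) (p (minn i.+1 N)) <= L%:R.
  rewrite ler_nat; case: (ltnP i N) => iN.
    by rewrite (minn_idPl iN) pL.
  by rewrite (minn_idPr (leq_trans iN (leqnSn _))) word_distxx.
lra.
Qed.

Variables (ell : G -> nat) (L : nat).
Local Open Scope group_scope.
Hypothesis L_gt0 : (0 < L)%N.
Hypothesis ell1 : ell 1 = 0%N.
Hypothesis ellM : forall x y, (ell (x * y) <= ell x + ell y)%N.
Hypothesis ell_word : forall x, exists s : seq G,
  [/\ size s = ell x, forall z, z \in s -> (ell z <= 1)%N & \prod_(z <- s) z = x].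
Hypothesis wl_le_ell : forall z, (wl z <= L * ell z)%N.
Hypothesis ell_le_wl : forall z, (ell z <= L * wl z)%N.

Definition ell_geodesic (p : nat -> G) N :=
  forall i j, (i <= j <= N)%N -> ell ((p i)^-1 * p j) = (j - i)%N.

Local Open Scope ring_scope.

Lemma ell_geodesic_sub p N N' : (N' <= N)%N -> ell_geodesic p N -> ell_geodesic p N'.
Proof. by move=> NN h i j /andP[ij jN]; apply: h; rewrite ij (leq_trans jN). Qed.

Lemma ell_geodesic_lip p N i j : ell_geodesic p N -> (i <= j <= N)%N ->
  dQ (p i) (p j) <= L%:R * (j - i)%:R.
Proof. by move=> h ij; rewrite -natrM ler_nat -(h i j ij) wl_le_ell. Qed.

Lemma ell_geodesic_colip p N i j : ell_geodesic p N -> (i <= j <= N)%N ->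
  (j - i)%:R <= L%:R * dQ (p i) (p j).
Proof. by move=> h ij; rewrite -natrM ler_nat -(h i j ij) ell_le_wl. Qed.

(** The bound of [path_near_geodesic] is reversed by a connectedness argument. Each
point of the geodesic from p_0 to p_N is O(k)-close to some p_i; as one moves
along the geodesic from p_0 to p_N, these i pass from below a to above a, so some
point w is O(k)-close to both p_i and p_i' with i <= a <= i'. Then i' - i = O(k)
as p is a quasi-geodesic, so that p_a is O(k)-close to w. *)
Lemma gprod_geodesic_log : exists2 C : rat, 0 <= C & forall p N k a,
  ell_geodesic p N -> (N <= 2 ^ k)%N -> (a <= N)%N ->
  gprod S (p a) (p 0%N) (p N) <= C * k.+1%:R.
Proof.
pose D : rat := delta + L%:R + 1.
have L0 : 0 <= L%:R :> rat by [].
exists (D + L%:R * (L%:R * (2%:R * D + 1))).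
  rewrite /D; have d0 : 0 <= delta by have := delta_ge1; lra.
  by rewrite !(addr_ge0, mulr_ge0).
move=> p N k a pgeo Nk aN.
(* R is the closeness provided by [path_near_geodesic] *)
pose R : rat := k%:R * delta + L%:R + 1.
have k0 : 0 <= k%:R :> rat by [].
have d0 : 0 <= delta by have := delta_ge1; lra.
have R0 : 0 <= R by rewrite /R !addr_ge0// mulr_ge0.
have RD : R <= D * k.+1%:R.
  rewrite /R /D -[k.+1]addn1 natrD; have := mulr_ge0 k0 L0; nra.
have [w [w0 wM wgeo]] := word_geodesic S (p 0%N) (p N).
set M := d (p 0%N) (p N) in wM wgeo.
have onw j : (j <= M)%N -> gprod S (w j) (p 0%N) (p N) = 0.
  move=> jM; rewrite /gprod -/M.
  have -> : d (w j) (p 0%N) = j by rewrite word_distC -w0 wgeo ?jM ?subn0.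
  have -> : d (w j) (p N) = (M - j)%N by rewrite -wM wgeo ?jM ?leqnn.
  by rewrite natrB//; lra.
pose near j i := dQ (w j) (p i) <= R.
have [j jM [[i ia ni] [i' /andP[ai' i'N] ni']]] : exists2 j, (j <= M)%N &
    (exists2 i, (i <= a)%N & near j i) /\
    (exists2 i, (a <= i <= N)%N & dQ (w j) (p i) <= R + 1).
  apply: contrapT => no.
  have nearP j : (j <= M)%N -> exists2 i, (i <= a)%N & near j i.
    elim: j => [_|j IH jM].
      by exists 0%N => //; rewrite /near w0 word_distxx.
    have [i iN ni] : exists2 i, (i <= N)%N & near j.+1 i.
      apply: path_near_geodesic (onw _ jM) => // t tN.
      have := wl_le_ell ((p t)^-1 * p t.+1)%g.
      by rewrite pgeo ?leqnSn// subSnn muln1.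
    case: (leqP i a) => ia; first by exists i.
    exfalso; apply: no; exists j; first exact: ltnW.
    split; first by apply: IH; exact: ltnW.
    exists i; first by rewrite (ltnW ia).
    apply: le_trans (distQ_tri S (w j.+1) _ _) _.
    rewrite [d (w j) _]wgeo ?leqnSn// subSnn addrC lerD2r; exact: ni.
  apply: no; exists M => //; split; first exact: nearP.
  exists N; first by rewrite aN leqnn.
  by rewrite wM word_distxx addr_ge0.
have h1 : dQ (p i) (p i') <= 2%:R * R + 1.
  have := distQ_tri S (w j) (p i) (p i'); rewrite (word_distC S (p i) (w j)).
  rewrite /near in ni; lra.
have h2 : (i' - i)%:R <= L%:R * (2%:R * R + 1) :> rat.
  apply: le_trans (ell_geodesic_colip pgeo _) _; first by rewrite (leq_trans ia).
  exact: ler_wpM2l.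
have h3 : dQ (p i) (p a) <= L%:R * (L%:R * (2%:R * R + 1)).
  apply: le_trans (ell_geodesic_lip pgeo _) _; first by rewrite ia.
  apply: ler_wpM2l => //; apply: le_trans h2; rewrite ler_nat; lia.
have h4 : gprod S (p a) (p 0%N) (p N) <= R + L%:R * (L%:R * (2%:R * R + 1)).
  have := gprod_base_le S (p a) (w j) (p 0%N) (p N); rewrite onw//.
  have := distQ_tri S (p i) (p a) (w j).
  rewrite (word_distC S (p a) (p i)) (word_distC S (p i) (w j)).
  rewrite /near in ni; lra.
apply: le_trans h4 _.
have h5 : 2%:R * R + 1 <= (2%:R * D + 1) * k.+1%:R.
  by move: RD; rewrite -[k.+1]addn1 natrD; nra.
rewrite [leRHS]mulrDl -!mulrA; apply: lerD => //.
by do 2!apply: ler_wpM2l => //.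
Qed.

(** By induction on the number of doublings from s to t. Between the times s and t
of the same dyadic scale m, the product based at p_0 is the distance of p_0 and
p_s, of order 2^m, minus the O(m) of [gprod_geodesic_log]. Larger scales are joined
through p at time 2^(m+1); the delta lost there is what makes the lower bound
delta * m - K increase by delta with m, so the recursion closes. *)
Lemma gprod_geodesic_growth : exists K : rat, forall p N n m s t,
  ell_geodesic p N -> (2 ^ m <= s)%N -> (s <= t <= N)%N -> (t <= 2 ^ (m + n))%N ->
  delta * m%:R - K <= gprod S (p 0%N) (p s) (p t).
Proof.
have [C C0 hC] := gprod_geodesic_log.
have [K' hK'] := linear_le_expn2 (L%:R * (delta + C)).
have L0 : 0 <= L%:R :> rat by [].
have K'1 : 0 <= K' + 1 by have := hK' 0%N; rewrite mulr0 expn0 addrC.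
pose K := K' + 1 + 3%:R * C + delta.
exists K => p N n m s t pgeo ms st tn.
have direct u v k : (2 ^ k <= u)%N -> (u <= v <= N)%N -> (v <= 2 ^ k.+2)%N ->
    delta * k%:R - K + delta <= gprod S (p 0%N) (p u) (p v).
  move=> ku uv vk; case/andP: (uv) => uv' vN.
  rewrite gprod_swap.
  have := hC p v k.+2 u (ell_geodesic_sub vN pgeo) vk uv'.
  have := @ell_geodesic_colip p N 0 u pgeo (leq_trans uv' vN); rewrite subn0.
  have : (2 ^ k)%:R <= u%:R :> rat by rewrite ler_nat.
  rewrite /K -[k.+3]addn3 natrD => h1 h2 h3.
  have : L%:R * ((delta + C) * k%:R - (K' + 1)) <= L%:R * dQ (p 0%N) (p u).
    have := hK' k; have : 1 <= L%:R :> rat by rewrite ler1n.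
    nra.
  rewrite ler_pM2l ?ltr0n//; nra.
have d1 := delta_ge1.
elim: n m s t ms st tn => [|n IH] m s t ms st tn.
  have : delta * m%:R - K + delta <= gprod S (p 0%N) (p s) (p t).
    by apply: direct => //; rewrite addn0 in tn; rewrite !expnS; lia.
  lra.
case: (leqP t (2 ^ m.+2)) => [t4|t4].
  by have := direct s t m ms st t4; lra.
rewrite addnS -addSn in tn.
case: (leqP (2 ^ m.+1) s) => s2.
  by have := IH m.+1 s t s2 st tn; rewrite -[m.+1]addn1 natrD; lra.
case/andP: (st) => st' tN.
have h1 : delta * m%:R - K + delta <= gprod S (p 0%N) (p s) (p (2 ^ m.+1)%N).
  by apply: direct => //; rewrite ?(ltnW s2) /= ?leq_exp2l//; move: t4; rewrite !expnS; lia.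
have h2 : delta * m.+1%:R - K <= gprod S (p 0%N) (p (2 ^ m.+1)%N) (p t).
  by apply: IH => //; rewrite tN andbT; move: t4; rewrite !expnS; lia.
have := hypS (p 0%N) (p s) (p (2 ^ m.+1)%N) (p t).
have : delta * m%:R - K + delta <=
    Num.min (gprod S (p 0%N) (p s) (p (2 ^ m.+1)%N)) (gprod S (p 0%N) (p (2 ^ m.+1)%N) (p t)).
  by rewrite le_min h1 /=; move: h2; rewrite -[m.+1]addn1 natrD; lra.
lra.
Qed.

(** A point x on an ell-geodesic from e to y fellow-travels y for a time that
grows with ell x, uniformly in y. *)
Lemma gprod_aligned_ge r : exists k0 : nat, forall x y, (k0 <= ell x)%N ->
  ell y = (ell x + ell (x^-1 * y)%g)%N -> r <= gprod S 1%g x y.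
Proof.
have [K hK] := gprod_geodesic_growth.
pose m := Num.bound `|r + K|.
have rm : r + K <= m%:R.
  by apply: le_trans (ler_norm _) _; rewrite ltW// archi_boundP.
exists (2 ^ m)%N => x y xm yE.
have [s [sx s1 sE]] := ell_word x.
have [t [tx t1 tE]] := ell_word (x^-1 * y)%g.
pose p := prefix_prod (s ++ t).
have p0 : p 0%N = 1%g by rewrite /p /prefix_prod take0 big_nil.
have px : p (ell x) = x by rewrite /p /prefix_prod -sx take_size_cat.
have yE' : (\prod_(z <- s ++ t) z)%g = y by rewrite big_cat /= sE tE mulVKg.
have py : p (ell y) = y.
  by rewrite /p /prefix_prod yE -sx -tx -size_cat take_size.
have sz : size (s ++ t) = ell y by rewrite size_cat sx tx.
have pgeo : ell_geodesic p (ell y).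
  move=> i j; rewrite -sz; apply: geodesic_of_word => //; last by rewrite yE' sz.
  by move=> z; rewrite mem_cat => /orP[/s1|/t1].
have xy : (ell x <= ell y <= ell y)%N by rewrite leqnn yE leq_addr.
have y2 : (ell y <= 2 ^ (m + ell y))%N.
  by rewrite (leq_trans (ltnW (ltn_expl (ell y) (isT : (1 < 2)%N))))// leq_exp2l// leq_addl.
have := hK p (ell y) (ell y) m (ell x) (ell y) pgeo xm xy y2.
rewrite p0 px py.
have d1 := delta_ge1; have : 0 <= m%:R :> rat by [].
nra.
Qed.

End QuasiGeodesic.

(** * Convolution powers, the norm of the support, and 0-Martin kernels *)

Section RandomWalkKernel.
Variables (R : realType) (G : groupType) (mu : G -> R).
Hypothesis mu_prob : prob_measure mu.
Hypothesis mu_fin : finite_set (msupp mu).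
Local Notation c := (conv_pow mu).
Local Notation ell := (mu_len mu).
Local Notation T := (fset_set (msupp mu)).
Local Notation aligned x y := (ell y = (ell x + ell (x^-1 * y)%g)%N).

Lemma mem_msupp z : (z \in T) = (0 < mu z).
Proof. by rewrite in_fset_set//; apply/idP/idP; rewrite inE. Qed.

Lemma mu_ge0 z : 0 <= mu z.
Proof. by case: mu_prob. Qed.

Lemma mu_notin z : z \notin T -> mu z = 0.
Proof. by rewrite mem_msupp lt_neqAle mu_ge0 andbT negbK => /eqP. Qed.

Lemma msupp_sum (F : G -> R) :
  \sum_(z \in [set: G]) mu z * F z = \sum_(z <- T) mu z * F z.
Proof.
rewrite -fsbig_finite//; apply/esym/fsbig_widen => // z [_ zT] /=.
by rewrite mu_notin ?mul0r// mem_msupp; apply/negP.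
Qed.

Lemma mu_sum1 : \sum_(z <- T) mu z = 1.
Proof.
case: mu_prob => _ <-; under eq_bigr do rewrite -[mu _]mulr1.
by rewrite -msupp_sum; apply: eq_fsbigr => z _; rewrite mulr1.
Qed.

Lemma conv_powS n x : c n.+1 x = \sum_(z <- T) mu z * c n (z^-1 * x)%g.
Proof. exact: msupp_sum. Qed.

Lemma conv_pow0 x : c 0 x = (x == 1%g)%:R.
Proof. by rewrite /=; case: ifP. Qed.

Lemma conv_pow_ge0 n x : 0 <= c n x.
Proof.
elim: n x => [|n IH] x; first by rewrite conv_pow0.
by rewrite conv_powS sumr_ge0// => z _; rewrite mulr_ge0 ?mu_ge0.
Qed.

(** Only one of the terms of the convolution formula for P^(n+m). *)
Lemma conv_powD n m x y : c n x * c m y <= c (n + m) (x * y)%g.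
Proof.
elim: n x => [|n IH] x.
  rewrite conv_pow0; case: eqP => [->|_]; first by rewrite mul1g mul1r.
  by rewrite mul0r conv_pow_ge0.
rewrite addSn !conv_powS mulr_suml ler_sum// => z _.
by rewrite -mulrA ler_wpM2l ?mu_ge0// mulgA.
Qed.

Lemma conv_pow1 x : c 1 x = mu x.
Proof.
have E z : ((z^-1 * x)%g == 1%g) = (z == x).
  apply/eqP/eqP => [h|->]; last exact: mulVg.
  by rewrite -[RHS](mulVKg z) h mulg1.
rewrite conv_powS; under eq_bigr do rewrite conv_pow0 E.
have [xT|xT] := boolP (x \in T).
  rewrite (bigD1_seq x) ?fset_uniq//= eqxx mulr1 big1 ?addr0// => z /negPf ->.
  by rewrite mulr0.
rewrite mu_notin// big_seq big1// => z zT.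
by case: eqP => [zx|_]; rewrite ?mulr0//; rewrite -zx zT in xT.
Qed.

(** An average is at most one of its terms. *)
Lemma conv_pow_step n y : exists2 z, 0 < mu z & c n.+1 y <= c n (z^-1 * y)%g.
Proof.
apply: contrapT => no.
have lt z : z \in T -> c n (z^-1 * y)%g < c n.+1 y.
  by rewrite mem_msupp => zT; rewrite ltNge; apply/negP => h; apply: no; exists z.
have: \sum_(z <- T | z \in T) mu z * c n (z^-1 * y)%g < \sum_(z <- T | z \in T) mu z * c n.+1 y.
  apply: ltr_sum => [|z zT]; last by rewrite ltr_pM2l ?lt// -mem_msupp.
  apply/negPn/negP => /hasPn T0; have /eqP := mu_sum1.
  by rewrite big_seq big1 ?(eq_sym 0) ?oner_eq0// => z zT; have := T0 z zT; rewrite zT.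
by rewrite -!big_seq -mulr_suml mu_sum1 mul1r -conv_powS ltxx.
Qed.

Lemma conv_pow_gt0P n x : 0 < c n x -> exists s : seq G,
  [/\ size s = n, forall z, z \in s -> 0 < mu z & (\prod_(z <- s) z)%g = x].
Proof.
elim: n x => [|n IH] x.
  rewrite conv_pow0; case: eqP => [-> _|]; last by rewrite ltxx.
  by exists [::]; rewrite big_nil.
have [z z0 zx] := conv_pow_step n x.
move=> /lt_le_trans/(_ zx)/IH[s [sn s0 sE]].
exists (z :: s); split; rewrite /= ?sn//; last by rewrite big_cons sE mulVKg.
by move=> t; rewrite inE => /orP[/eqP ->|/s0].
Qed.

Lemma conv_pow_prod_gt0 s : (forall z, z \in s -> 0 < mu z) ->
  0 < c (size s) (\prod_(z <- s) z)%g.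
Proof.
elim: s => [|z s IH] hs; first by rewrite big_nil [size _]/= conv_pow0 eqxx.
rewrite big_cons; apply: lt_le_trans (conv_powD 1 (size s) z _).
rewrite conv_pow1 mulr_gt0 ?hs ?mem_head// IH// => t ts.
by rewrite hs// inE ts orbT.
Qed.

Lemma finite_conv_pow_gt0 n : finite_set [set x | 0 < c n x].
Proof.
elim: n => [|n IH].
  apply: (sub_finite_set _ (finite_set1 1%g)) => x /=.
  by case: eqP => //; rewrite ltxx.
apply: (@sub_finite_set _ _ (\bigcup_(z in msupp mu) ((fun x => z * x)%g @` [set x | 0 < c n x]))).
  move=> x x0; have [z z0 zx] := conv_pow_step n x.
  exists z => //; exists (z^-1 * x)%g; last by rewrite mulVKg.
  exact: lt_le_trans zx.
by apply: bigcup_finite => // z _; exact: finite_image.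
Qed.

Lemma trans_prob1 n x : trans_prob mu n 1%g x = c n x.
Proof. by rewrite /trans_prob invg1 mul1g. Qed.

Lemma mu_len_le n x : 0 < c n x -> (ell x <= n)%N.
Proof. by move=> h; apply: ninf_le => /=; rewrite trans_prob1. Qed.

Hypothesis mu_adm : admissible mu.

Lemma mu_lenP x : 0 < c (ell x) x.
Proof.
have [s [_ s0 <-]] := mu_adm x; set y := (\prod_(z <- s) z)%g.
rewrite -trans_prob1; apply: (@ninf_in [set n | 0 < trans_prob mu n 1%g y] (size s)) => /=.
by rewrite trans_prob1; exact: conv_pow_prod_gt0.
Qed.

Lemma mu_len1 : ell 1%g = 0%N.
Proof. by apply/eqP; rewrite -leqn0; apply: mu_len_le; rewrite conv_pow0 eqxx. Qed.

Lemma mu_lenM x y : (ell (x * y)%g <= ell x + ell y)%N.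
Proof.
by apply: mu_len_le; apply: lt_le_trans (conv_powD _ _ _ _); rewrite mulr_gt0 ?mu_lenP.
Qed.

Lemma mu_len_supp z : 0 < mu z -> (ell z <= 1)%N.
Proof. by move=> z0; rewrite mu_len_le// conv_pow1. Qed.

Lemma mu_len_word x : exists s : seq G,
  [/\ size s = ell x, forall z, z \in s -> (ell z <= 1)%N & (\prod_(z <- s) z)%g = x].
Proof.
have [s [ss s0 sE]] := conv_pow_gt0P (mu_lenP x).
by exists s; split=> // z /s0 /mu_len_supp.
Qed.

Lemma finite_mu_ball k : finite_set [set x | (ell x < k)%N].
Proof.
apply: (@sub_finite_set _ _ (\bigcup_(n in `I_k) [set x | 0 < c n x])).
  by move=> x /= xk; exists (ell x) => //; exact: mu_lenP.
by apply: bigcup_finite => // n _; exact: finite_conv_pow_gt0.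
Qed.

Lemma kernel_gt0_aligned x y : 0 < martin_kernel0 mu x y -> aligned x y.
Proof. by rewrite /martin_kernel0; case: eqP => // _; rewrite ltxx. Qed.

Lemma kernel_ge0 x y : 0 <= martin_kernel0 mu x y.
Proof.
by rewrite /martin_kernel0; case: ifP => // _; rewrite divr_ge0 ?conv_pow_ge0.
Qed.

(** P^|y|(e, y) is at least P^|x|(e, x) P^(|y|-|x|)(x, y). *)
Lemma kernel_le x y : martin_kernel0 mu x y <= (c (ell x) x)^-1.
Proof.
rewrite /martin_kernel0; case: eqP => [xy|_]; last by rewrite invr_ge0 conv_pow_ge0.
rewrite trans_prob1 ler_pdivrMr ?mu_lenP// mulrC ler_pdivlMr ?mu_lenP//.
rewrite xy addKn /trans_prob mulrC; apply: le_trans (conv_powD _ _ _ _) _.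
by rewrite mulVKg.
Qed.

(** Iterating [conv_pow_step] k times gives x with P^k(e, x) > 0 and
P^(|y|-k)(x, y) >= P^|y|(e, y) > 0; both lengths are then at most what positivity
allows, and the triangle inequality forces x to be on a geodesic at distance k. *)
Lemma kernel_ge1_ex k y : (k <= ell y)%N ->
  exists2 x, ell x = k & 1 <= martin_kernel0 mu x y.
Proof.
move=> ky.
have [x xk xy] : exists2 x, 0 < c k x & c (ell y) y <= c (ell y - k) (x^-1 * y)%g.
  elim: k ky => [|k IH] ky.
    by exists 1%g; rewrite ?conv_pow0 ?eqxx// subn0 invg1 mul1g.
  have [x xk xy] := IH (ltnW ky).
  have := conv_pow_step (ell y - k.+1) (x^-1 * y)%g.
  rewrite -subSn// subSS => -[z z0 zy]; exists (x * z)%g.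
    rewrite -addn1; apply: lt_le_trans (conv_powD _ _ _ _).
    by rewrite conv_pow1 mulr_gt0.
  by rewrite invgM -mulgA (le_trans xy).
have lx := mu_len_le xk.
have lxy : (ell (x^-1 * y)%g <= ell y - k)%N.
  by apply: mu_len_le; exact: lt_le_trans (mu_lenP y) xy.
have := mu_lenM x (x^-1 * y)%g; rewrite mulVKg => ly.
have ex : ell x = k by apply/eqP; move: ky lx lxy ly; clear; lia.
have exy : aligned x y by apply/eqP; move: ky lx lxy ly; clear; lia.
exists x => //; rewrite /martin_kernel0 exy eqxx -exy ex trans_prob1 /trans_prob.
by rewrite ler_pdivlMr ?mu_lenP// mul1r.
Qed.

(** The norms of the generating set S and of the support of mu are Lipschitz
equivalent, both sets being finite. *)
Lemma mu_aligned_gprod_ge (S : genset G) : hyperbolic S ->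
  forall r, exists k0 : nat, forall x y, (k0 <= ell x)%N -> aligned x y ->
  r <= gprod S 1%g x y.
Proof.
move=> [delta hyp].
pose L1 := \max_(z <- T) word_len S z.
pose L2 := \max_(z <- fset_set (gens S)) (ell z + ell z^-1%g)%N.
pose L := (L1 + L2).+1.
have hL1 z : (word_len S z <= L * ell z)%N.
  have [s [<- s0 <-]] := conv_pow_gt0P (mu_lenP z).
  elim: s s0 => [|t s IH] s0; first by rewrite big_nil word_len1.
  rewrite big_cons /= mulnS (leq_trans (word_lenM _ _ _))// leq_add//; last first.
    by apply: IH => u us; rewrite s0// inE us orbT.
  have tT : t \in T by rewrite mem_msupp s0// mem_head.
  rewrite (leq_trans (@leq_bigmax_seq _ _ xpredT (word_len S) _ tT isT))// -/L1.
  by rewrite /L -addSn leqW// leq_addr.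
have hL2 z : (ell z <= L * word_len S z)%N.
  have [s [<- ss <-]] := word_lenP S z.
  elim: s ss => [|t s IH] ss; first by rewrite big_nil mu_len1.
  rewrite big_cons /= mulnS (leq_trans (mu_lenM _ _))// leq_add//; last first.
    by apply: IH => u us; apply: ss; rewrite inE us orbT.
  have memS u : gens S u -> u \in fset_set (gens S).
    by move=> Su; rewrite in_fset_set ?inE//; exact: gens_finite.
  pose F u := (ell u + ell u^-1%g)%N.
  have : (ell t <= L2)%N.
    case: (ss t (mem_head _ _)) => /memS tS.
      by rewrite (leq_trans _ (@leq_bigmax_seq _ _ xpredT F _ tS isT))// leq_addr.
    by rewrite (leq_trans _ (@leq_bigmax_seq _ _ xpredT F _ tS isT))// /F invgK leq_addl.
  by move=> /leq_trans; apply; rewrite /L leqW// leq_addl.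
have d1 : 1 <= Num.max delta 1 by rewrite le_max lexx orbT.
apply: (@gprod_aligned_ge _ S _ d1 _ ell L) => //.
- move=> w x y z; apply: le_trans (hyp w x y z).
  by rewrite lerD2l lerN2 le_max lexx.
- exact: mu_len1.
- exact: mu_lenM.
- exact: mu_len_word.
Qed.

End RandomWalkKernel.

(** * The projection to the Gromov compactification *)

Section GromovSequences.
Variables (G : groupType) (S : genset G) (delta : rat).
Hypothesis hypS : forall w x y z : G,
  Num.min (gprod S w x y) (gprod S w y z) - delta <= gprod S w x z.

Lemma gprod_triangle r w x y z : r + delta <= gprod S w x y ->
  r + delta <= gprod S w y z -> r <= gprod S w x z.
Proof.
move=> xy yz; apply: le_trans (hypS w x y z).
by rewrite lerBrDr le_min xy.
Qed.

Lemma gprod_geC r u v : gprod_ge S r u v -> gprod_ge S r v u.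
Proof. by move=> [N hN]; exists N => i j Ni Nj; rewrite gprodC hN. Qed.

Lemma gromov_equiv_trans u v w :
  gromov_equiv S u v -> gromov_equiv S v w -> gromov_equiv S u w.
Proof.
move=> uv vw r; have [N hN] := uv (r + delta); have [M hM] := vw (r + delta).
exists (maxn N M) => i j; rewrite !geq_max => /andP[Ni Mi] /andP[Nj Mj].
by apply: (gprod_triangle (hN _ (maxn N M) _ _) (hM (maxn N M) _ _ _));
  rewrite ?leq_maxl ?leq_maxr.
Qed.

Lemma bdry_class_eq u v : gromov_equiv S u v -> bdry_class S u = bdry_class S v.
Proof.
move=> uv; have vu : gromov_equiv S v u by move=> r; exact: gprod_geC.
by apply/seteqP; split=> w [gw ew]; split=> //; apply: gromov_equiv_trans ew.
Qed.

(** The product of u m with itself based at e is the norm of u m. *)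
Lemma gromov_seq_unbounded u n : gromov_seq S u ->
  exists N, forall m, (N <= m)%N -> (n < word_len S (u m))%N.
Proof.
move=> gu; have [N hN] := gu n.+1%:R; exists N => m Nm.
have := hN m m Nm Nm; rewrite /gprod word_distxx word_dist1.
by rewrite -(ler_nat rat); lra.
Qed.

Lemma GBd_inj_sval (c c' : gromov_bdry S) : sval c = sval c' -> GBd c = GBd c'.
Proof. by case: c c' => [c h] [c' h'] /= cc'; congr GBd; exact: eq_exist. Qed.

End GromovSequences.

Section Projection.
Variables (R : realType) (G : groupType) (S : genset G) (mu : G -> R).
Hypothesis hypS : hyperbolic S.
Hypothesis mu_prob : prob_measure mu.
Hypothesis mu_fin : finite_set (msupp mu).
Hypothesis mu_adm : admissible mu.
Variables (X : topologicalType) (i : G -> X).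
Hypothesis i_cpt : compactification i.
Hypothesis i_ext : martin0_extends mu i.
Local Notation ell := (mu_len mu).
Local Notation aligned x y := (ell y = (ell x + ell (x^-1 * y)%g)%N).

(** The points of X near which all group elements have x on a geodesic from e. It
replaces the positivity of the extended kernel of x, and is open by definition. *)
Definition precedes (x : G) : set X := interior [set q | forall y, q = i y -> aligned x y].

(** A geodesic ray towards p, up to the fact that consecutive points need not be
adjacent; each x k is on a geodesic from e to all elements close to p. *)
Definition ray_to (p : X) (x : nat -> G) : Prop :=
  forall k, ell (x k) = k /\ precedes (x k) p.

Definition seq_cluster (u : nat -> G) (p : X) : Prop :=
  forall V, nbhs p V -> forall N, exists2 n, (N <= n)%N & V (i (u n)).

Lemma open_precedes x : open (precedes x).
Proof. exact: open_interior. Qed.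

Lemma precedes_aligned x y : precedes x (i y) -> aligned x y.
Proof. by move=> /interior_subset; exact. Qed.

Lemma cpt_closed1 (p : X) : closed [set p].
Proof.
by case: i_cpt => _ h _ _ _; apply: accessible_closed_set1; exact: hausdorff_accessible.
Qed.

Lemma cpt_nbhs1 x : nbhs (i x) [set i x].
Proof. by case: i_cpt => _ _ _ h _; apply: open_nbhs_nbhs; split. Qed.

Lemma cpt_meet (V : set X) (p : X) : nbhs p V -> exists y, V (i y).
Proof.
case: i_cpt => _ _ _ _ dns; rewrite nbhsE => -[U [oU Up] UV].
have [|q [Uq [y _ yE]]] := dns U _ oU; first by exists p.
by exists y; rewrite yE; exact: UV.
Qed.

Lemma cpt_closed_range (C : set X) : closed C -> (forall y, C (i y)) -> C = setT.
Proof.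
move=> cC hC; apply/seteqP; split=> // p _; apply: contrapT => Cp.
have [|y] := @cpt_meet (~` C) p; last by move=> /(_ (hC y)).
by apply: open_nbhs_nbhs; split => //; exact: closed_openC.
Qed.

(** The elements y of norm at least k are covered by the finitely many closed sets
where the kernel of some x of norm k is at least 1, by [kernel_ge1_ex]. Together with
the ball of radius k these sets cover the dense image of the group, hence X. *)
Lemma precedes_ex (p : X) k : ~ range i p -> exists2 x, ell x = k & precedes x p.
Proof.
move=> pG.
have h x : exists k : X -> R, continuous k /\ forall y, k (i y) = martin_kernel0 mu x y.
  by have [k' kc kE] := i_ext x; exists k'.
have [kx hk] := choice h.
pose C := \bigcup_(y in [set y | (ell y < k)%N]) [set i y] `|`
  \bigcup_(x in [set x | ell x = k]) (kx x @^-1` [set r | 1 <= r]).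
have cC : closed C.
  apply: closedU; apply: closed_bigcup.
  - exact: finite_mu_ball.
  - by move=> y _; exact: cpt_closed1.
  - apply: (sub_finite_set _ (finite_mu_ball mu_prob mu_fin mu_adm k.+1)).
    by move=> x /= ->.
  - move=> x _; apply: closed_comp; last exact: closed_ge.
    by move=> q _; case: (hk x) => + _; exact.
have CT : C = setT.
  apply: cpt_closed_range => // y; case: (ltnP (ell y) k) => ky; first by left; exists y.
  have [x xk xy] := kernel_ge1_ex mu_prob mu_fin mu_adm ky.
  by right; exists x; rewrite //= (hk x).2.
have : C p by rewrite CT.
case=> [[y _ /= py]|[x /= xk xp]]; first by exfalso; apply: pG; exists y.
exists x => //; rewrite /precedes /interior.
have [kc kE] := hk x.
have : nbhs p (kx x @^-1` [set r | 0 < r]).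
  apply: kc; apply: open_nbhs_nbhs; split; first exact: open_gt.
  exact: lt_le_trans xp.
by apply: filterS => q /= q0 y qy; apply: (@kernel_gt0_aligned _ _ mu); rewrite -kE -qy.
Qed.

Lemma ray_to_ex (p : X) : ~ range i p -> exists x, ray_to p x.
Proof.
move=> pG; have h k : exists x, ell x = k /\ precedes x p.
  by have [x xk xp] := precedes_ex k pG; exists x.
by have [x hx] := choice h; exists x.
Qed.

(** Two elements x and z on geodesics to a common y are close to each other, seen
from e, as both are close to y. *)
Lemma aligned_pair_ge r : exists k0 : nat,
  (forall x y, (k0 <= ell x)%N -> aligned x y -> r <= gprod S 1%g x y) /\
  (forall x z y, (k0 <= ell x)%N -> (k0 <= ell z)%N -> aligned x y -> aligned z y ->
    r <= gprod S 1%g x z).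
Proof.
have [delta hyp] := hypS.
have [k1 h1] := mu_aligned_gprod_ge mu_prob mu_fin mu_adm hypS r.
have [k2 h2] := mu_aligned_gprod_ge mu_prob mu_fin mu_adm hypS (r + delta).
exists (maxn k1 k2); split=> [x y|x z y]; rewrite !geq_max.
  by move=> /andP[xk _]; exact: h1.
move=> /andP[_ xk] /andP[_ zk] xy zy.
by apply: (gprod_triangle hyp (h2 x y xk xy)); rewrite gprodC h2.
Qed.

Lemma precedes_pair (p : X) x z : precedes x p -> precedes z p ->
  exists2 y, aligned x y & aligned z y.
Proof.
move=> xp zp; have [|y [/precedes_aligned xy /precedes_aligned zy]] :=
  @cpt_meet (precedes x `&` precedes z) p; last by exists y.
by apply: filterI; apply: open_nbhs_nbhs; split=> //; exact: open_precedes.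
Qed.

Lemma ray_pair_ge r : exists k0 : nat, forall p x z j k,
  ray_to p x -> ray_to p z -> (k0 <= j)%N -> (k0 <= k)%N ->
  r <= gprod S 1%g (x j) (z k).
Proof.
have [k0 [_ h]] := aligned_pair_ge r; exists k0 => p x z j k xr zr jk kk.
have [xj xp] := xr j; have [zk zp] := zr k.
have [y xy zy] := precedes_pair xp zp.
by apply: (h _ _ y) => //; rewrite ?xj ?zk.
Qed.

(** For x = z, this says that a ray is a Gromov sequence. *)
Lemma ray_gromov_equiv p x z : ray_to p x -> ray_to p z -> gromov_equiv S x z.
Proof.
by move=> xr zr r; have [k0 h] := ray_pair_ge r; exists k0 => j k; exact: (h p).
Qed.

Lemma ray_gromov_seq p x : ray_to p x -> gromov_seq S x.
Proof. by move=> xr; exact: (ray_gromov_equiv xr xr). Qed.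

Lemma seq_cluster_notin u p : gromov_seq S u -> seq_cluster u p -> ~ range i p.
Proof.
move=> gu up [g _ gp]; have [N hN] := gromov_seq_unbounded (word_len S g) gu.
have [n /hN] := up _ (eq_ind _ (fun q => nbhs q [set i g]) (cpt_nbhs1 g) _ gp) N.
by case: i_cpt => _ _ inj _ _ /[swap] /= /inj ->; rewrite ltnn.
Qed.

(** Each x k is on a geodesic from e to some u n with n as large as wanted. *)
Lemma seq_cluster_ray u p x : gromov_seq S u -> seq_cluster u p -> ray_to p x ->
  gromov_equiv S x u.
Proof.
move=> gu up xr r; have [delta hyp] := hypS.
have [k0 [h _]] := aligned_pair_ge (r + delta).
have [N hN] := gu (r + delta).
exists (maxn k0 N) => k m; rewrite !geq_max => /andP[kk _] /andP[_ Nm].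
have [xk xp] := xr k.
have [|n Nn /precedes_aligned xy] := up (precedes (x k)) _ N.
  by apply: open_nbhs_nbhs; split=> //; exact: open_precedes.
by apply: (gprod_triangle hyp (h _ _ _ xy)); rewrite ?xk ?hN.
Qed.

Lemma seq_cluster_ex u : exists p, seq_cluster u p.
Proof.
case: i_cpt => cpt _ _ _ _.
have [|p [_ up]] := cpt ((i \o u) @ \oo) _; first exact: filterT.
exists p => V Vp N.
have [|_ [[n /= Nn <-] Vn]] := up ((i \o u) @` [set n | (N <= n)%N]) V _ Vp; last by exists n.
by exists N => // n Nn; exists n.
Qed.

(** The value at p does not depend on the ray by [ray_gromov_equiv]. *)
Lemma projection_fun_ex : exists f : X -> gromov_cpt S,
  (forall x, f (i x) = GIn S x) /\
  forall p x, ray_to p x -> ~ range i p ->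
    exists2 c, f p = GBd c & sval c = bdry_class S x.
Proof.
have h p : exists q : gromov_cpt S,
    (forall x, i x = p -> q = GIn S x) /\
    forall x, ray_to p x -> ~ range i p -> exists2 c, q = GBd c & sval c = bdry_class S x.
  have [[x _ xp]|pG] := pselect (range i p).
    exists (GIn S x); split=> [y yp|y _ []]; last by exists x.
    by case: i_cpt => _ _ inj _ _; congr GIn; apply: inj; rewrite xp yp.
  have [x xr] := ray_to_ex pG.
  have cP : exists2 u, gromov_seq S u & bdry_class S x = bdry_class S u.
    by exists x => //; exact: ray_gromov_seq xr.
  pose c : gromov_bdry S := exist _ _ cP.
  exists (GBd c); split=> [y yp|z zr _]; first by case: pG; exists y.
  have [delta hyp] := hypS.
  exists c => //=.
  exact: (bdry_class_eq hyp (ray_gromov_equiv xr zr)).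
have [f hf] := choice h.
exists f; split=> [x|p]; first exact: (hf (i x)).1.
exact: (hf p).2.
Qed.

Variable f : X -> gromov_cpt S.
Hypothesis f_in : forall x, f (i x) = GIn S x.
Hypothesis f_bd : forall p x, ray_to p x -> ~ range i p ->
  exists2 c, f p = GBd c & sval c = bdry_class S x.

Lemma projection_limit u p : gromov_seq S u -> seq_cluster u p ->
  exists2 c, f p = GBd c & sval c = bdry_class S u.
Proof.
move=> gu up; have pG := seq_cluster_notin gu up; have [x xr] := ray_to_ex pG.
have [c fp cE] := f_bd xr pG; exists c => //; have [delta hyp] := hypS.
by rewrite cE; exact: (bdry_class_eq hyp (seq_cluster_ray gu up xr)).
Qed.

Lemma projection_surjective q : exists p, f p = q.
Proof.
case: q => [x|c]; first by exists (i x).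
have [u gu cE] := svalP c; have [p up] := seq_cluster_ex u.
have [c' fp c'E] := projection_limit gu up.
by exists p; rewrite fp; apply: GBd_inj_sval; rewrite c'E cE.
Qed.

(** The points q preceded by a far element of a ray to p form a neighbourhood of p;
the image of each of them shares that element with the ray to p, so it is close to
the image of p. *)
Lemma projection_continuous : continuous f.
Proof.
apply/continuousP => U oU; rewrite openE => p Up.
have [[x _ xp]|pG] := pselect (range i p).
  rewrite -xp in Up *; rewrite /interior; apply: filterS (cpt_nbhs1 x).
  by move=> q /= ->.
have [x xr] := ray_to_ex pG.
have [c fp cE] := f_bd xr pG; have [delta hyp] := hypS.
have [r hr] : exists r, forall q, gromov_near r (GBd c) q -> U q.
  by apply: oU; rewrite -fp.
have [k0 [h1 h2]] := aligned_pair_ge (r + delta).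
have [xk xp] := xr k0.
have xc : sval c x by rewrite cE; split; exact: (ray_gromov_seq xr).
have [k1 h3] := ray_pair_ge (r + delta).
rewrite /interior; have : nbhs p (precedes (x (maxn k0 k1))).
  by apply: open_nbhs_nbhs; split; [exact: open_precedes | exact: (xr _).2].
apply: filterS => q qx; apply: hr; rewrite /gromov_near.
have mk := (xr (maxn k0 k1)).1.
have [[y _ yq]|qG] := pselect (range i q).
  exists x, (fun=> y); rewrite -yq f_in; split => //.
  exists k1 => m _ k1m _; apply: (gprod_triangle hyp (y := x (maxn k0 k1))).
    by apply: (h3 p) => //; rewrite leq_maxr.
  apply: h1; first by rewrite mk leq_maxl.
  by apply: precedes_aligned; rewrite yq.
have [z zr] := ray_to_ex qG; have [c' fq c'E] := f_bd zr qG.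
exists x, z; rewrite fq; split => //.
  by rewrite /= c'E; split; exact: (ray_gromov_seq zr).
exists (maxn k0 k1) => m n; rewrite !geq_max => /andP[_ k1m] /andP[k0n _].
apply: (gprod_triangle hyp (y := x (maxn k0 k1))).
  by apply: (h3 p) => //; rewrite leq_maxr.
have [zk zq] := zr n.
have [y xy zy] := precedes_pair qx zq.
by apply: (h2 _ _ y) => //; rewrite ?mk ?zk ?leq_maxl.
Qed.

Lemma left_mul_ext_nbhs g p q V W : left_mul_ext i g p q -> nbhs p V -> nbhs q W ->
  exists y, V (i y) /\ W (i (g * y)%g).
Proof.
move=> pq Vp Wq; have [|_ [[y _ <-] [/= Vy Wy]]] := pq (V `*` W); last by exists y.
by exists (V, W).
Qed.

(** If (p, q) is in the closure of the graph of left multiplication by g, then for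
all j and k some y has x j on a geodesic to y and z k on a geodesic to g y. So
g x and z have large products with a common element, where g x is used in the given
metric only, in which left multiplication moves products by at most |g|. *)
Lemma projection_equivariant : equivariant_to_gromov i f.
Proof.
move=> g p q pq; case: (i_cpt) => _ _ inj _ _.
have [[x _ xp]|pG] := pselect (range i p).
  have -> : q = i (g * x)%g.
    apply: contrapT => qx.
    have [||y [/= yx]] := left_mul_ext_nbhs (V := [set i x]) (W := ~` [set i (g * x)%g]) pq.
    - by rewrite -xp; exact: cpt_nbhs1.
    - by apply: open_nbhs_nbhs; split => //; apply: closed_openC; exact: cpt_closed1.
    - by rewrite (inj _ _ yx).
  by rewrite -xp !f_in.
have [[z _ zq]|qG] := pselect (range i q).
  exfalso; apply: pG; exists (g^-1 * z)%g => //; apply: contrapT => px.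
  have [||y [/= yx yz]] := left_mul_ext_nbhs (V := ~` [set i (g^-1 * z)%g]) (W := [set i z]) pq.
  - by apply: open_nbhs_nbhs; split => [|/= /esym//]; apply: closed_openC; exact: cpt_closed1.
  - by rewrite -zq; exact: cpt_nbhs1.
  - by apply: yx; rewrite -(inj _ _ yz) mulKg.
have [x xr] := ray_to_ex pG; have [c fp cE] := f_bd xr pG.
have [z zr] := ray_to_ex qG; have [c' fq c'E] := f_bd zr qG.
have [delta hyp] := hypS.
rewrite fp fq /=; apply: GBd_inj_sval; rewrite c'E.
(* the two sides are compared after translation by g, which is where |g^-1| enters *)
have gx_z : gromov_equiv S (fun n => g * x n)%g z.
  move=> r; have [k1 [h1 _]] := aligned_pair_ge (r + delta).
  have [k2 [h2 _]] := aligned_pair_ge (r + delta + (word_len S g^-1%g)%:R).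
  exists (maxn k1 k2) => j k; rewrite !geq_max => /andP[_ jk] /andP[kk _].
  have [xj xp] := xr j; have [zk zq] := zr k.
  have [y [/precedes_aligned xy /precedes_aligned zy]] := left_mul_ext_nbhs pq
    (open_nbhs_nbhs (conj (@open_precedes (x j)) xp))
    (open_nbhs_nbhs (conj (@open_precedes (z k)) zq)).
  apply: (gprod_triangle hyp (y := (g * y)%g)).
    apply: le_trans (gprod_shift _ _ _ _); rewrite lerBrDr; apply: h2 xy.
    by rewrite xj.
  by rewrite gprodC; apply: h1 zy; rewrite zk.
have [u gu uE] := svalP (bdry_act g c).
have : sval (bdry_act g c) z.
  rewrite /= cE; split.
    by apply: gprod_ge_shift; exact: (ray_gromov_seq zr).
  apply: (@gprod_ge_unshift _ _ g) => r; have := gx_z r.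
  by congr gprod_ge; apply/funext => n; rewrite mulVKg.
by rewrite uE => -[gz uz]; apply/esym; exact: (bdry_class_eq hyp uz).
Qed.

End Projection.

(** The value at the cluster points of Gromov sequences gives surjectivity, and
identifies the images of two limits in the example. *)
Lemma projection_ex (R : realType) (G : groupType) (S : genset G) (mu : G -> R)
    (X : topologicalType) (i : G -> X) :
  hyperbolic S -> prob_measure mu -> finite_set (msupp mu) -> admissible mu ->
  compactification i -> martin0_extends mu i ->
  exists2 f : X -> gromov_cpt S, gromov_projection i f &
    forall u p, gromov_seq S u -> seq_cluster i u p ->
      exists2 c, f p = GBd c & sval c = bdry_class S u.
Proof.
move=> hypS mu_prob mu_fin mu_adm i_cpt i_ext.
have [f [f_in f_bd]] := projection_fun_ex hypS mu_prob mu_fin mu_adm i_cpt i_ext.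
exists f; last exact: projection_limit f_bd.
split => //; first exact: projection_equivariant f_bd.
  exact: projection_surjective f_bd.
exact: projection_continuous f_bd.
Qed.

(** * Construction of the 0-Martin compactification *)

Lemma continuous_ptws (Y : topologicalType) (I : eqType) (T : topologicalType)
    (h : Y -> {ptws I -> T}) :
  (forall a, continuous (fun y => h y a)) -> continuous h.
Proof.
move=> hc y; apply/cvg_sup => a.
exact: (@continuous_comp_initial {ptws I -> T} Y T (fun f => f a) h (hc a)).
Qed.

Lemma compact_set_type (T : topologicalType) (A : set T) :
  compact A -> compact [set: set_type A].
Proof.
move=> cA F PF _; have [|p [Ap clp]] := cA (set_val @ F) _.
  apply: (@filterS _ F _ setT) => [q _|]; [exact: set_valP | exact: filterT].
exists (SigSub (mem_set Ap)); split=> // B C FB [_ [[U oU <-] Up] UC].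
have [_ [[q Bq <-] Uq]] := clp (set_val @` B) U
  (filterS (fun q Bq => (ex_intro2 _ _ q Bq erefl)) FB)
  (open_nbhs_nbhs (conj oU Up)).
by exists q; split=> //; exact: UC.
Qed.

Section Model.
Variables (R : realType) (G : groupType) (mu : G -> R).
Hypothesis mu_prob : prob_measure mu.
Hypothesis mu_fin : finite_set (msupp mu).
Hypothesis mu_adm : admissible mu.
Local Notation prodT := {ptws (G * bool)%type -> R}.

(** The second coordinate selects the indicator of a point rather than its kernel;
the indicators make the points of the group isolated in the closure. *)
Definition kernel_point (y : G) : prodT := fun a =>
  if a.2 then (a.1 == y)%:R else martin_kernel0 mu a.1 y.

Definition martin_space := set_type (closure (range kernel_point)).

HB.instance Definition _ := Topological.on martin_space.

Lemma martin_in_subproof y : kernel_point y \in closure (range kernel_point).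
Proof. by rewrite inE; apply: subset_closure; exists y. Qed.

Definition martin_in (y : G) : martin_space := SigSub (martin_in_subproof y).

Lemma martin_inE y : (set_val (martin_in y) : prodT) = kernel_point y.
Proof. by []. Qed.

Lemma martin_coord_continuous a : continuous (fun p : martin_space => (set_val p : prodT) a).
Proof.
move=> p; apply: (@continuous_comp _ _ _ (set_val : martin_space -> prodT) (fun f : prodT => f a)).
  exact: initial_continuous.
exact: (@proj_continuous _ (fun _ => R) a).
Qed.

(** The image of the group is dense in its closure. *)
Lemma martin_in_closed (C : set martin_space) : closed C ->
  (forall y, C (martin_in y)) -> forall p, C p.
Proof.
move=> cC hC p; apply: contrapT => Cp.
have [U oU UE] : open (~` C) by exact: closed_openC.
have Up : U (set_val p) by rewrite -[U _]/((set_val @^-1` U) p) UE.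
have [_ [[y _ <-] Uy]] := (set_valP p) U (open_nbhs_nbhs (conj oU Up)).
have : (~` C) (martin_in y) by rewrite -UE.
by apply.
Qed.

Lemma martin_space_hausdorff : hausdorff_space martin_space.
Proof.
move=> p q pq; apply: val_inj.
have hP : hausdorff_space prodT by apply: hausdorff_product => _; exact: Rhausdorff.
apply: hP => A B pA qB.
have [r [Ar Br]] := pq _ _ (@initial_continuous _ _ (set_val : martin_space -> prodT) p _ pA)
   (@initial_continuous _ _ (set_val : martin_space -> prodT) q _ qB).
by exists (set_val r).
Qed.

Lemma kernel_point_bounds y a : 0 <= kernel_point y a <= 1 + (conv_pow mu (mu_len mu a.1) a.1)^-1.
Proof.
have c0 x n : 0 <= (conv_pow mu n x)^-1 by rewrite invr_ge0 conv_pow_ge0.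
rewrite /kernel_point; case: a.2; last first.
  by rewrite kernel_ge0// (le_trans (kernel_le mu_prob mu_fin mu_adm _ _))// lerDr.
by rewrite ler0n /= ler_wpDr// lern1 leq_b1.
Qed.

Lemma martin_space_compact : compact [set: martin_space].
Proof.
apply: compact_set_type.
pose A (a : G * bool) : set R := `[0, 1 + (conv_pow mu (mu_len mu a.1) a.1)^-1]%classic.
have cA : compact [set f : prodT | forall a, A a (f a)].
  by apply: (@tychonoff _ (fun _ => R)) => a; exact: segment_compact.
apply: (subclosed_compact _ cA); first exact: closed_closure.
have hP : hausdorff_space prodT by apply: hausdorff_product => _; exact: Rhausdorff.
rewrite [X in _ `<=` X](closure_id _).1; last exact: compact_closed.
apply: closureS => _ [y _ <-] a; rewrite /A /= in_itv /=; exact: kernel_point_bounds.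
Qed.

Lemma martin_compactification : compactification martin_in.
Proof.
split.
- exact: martin_space_compact.
- exact: martin_space_hausdorff.
- move=> x y xy; have : kernel_point x (x, true) = kernel_point y (x, true).
    by rewrite -!martin_inE xy.
  by rewrite /kernel_point /= eqxx; case: eqP => // _ /eqP; rewrite oner_eq0.
- move=> x; have -> : [set martin_in x] =
      (fun p : martin_space => (set_val p : prodT) (x, true)) @^-1` [set r | 0 < r].
    apply/seteqP; split=> [_ ->|p xp].
      by rewrite [_ (_ _)]/= martin_inE /kernel_point /= eqxx.
    have : (set_val p : prodT) (x, true) <= 0 \/ p = martin_in x.
      move: p {xp}; apply: (@martin_in_closed ([set p : martin_space | (set_val p : prodT) (x, true) <= 0] `|` [set martin_in x])).
        apply: closedU.
          apply: (@closed_comp _ _ (fun p : martin_space => (set_val p : prodT) (x, true)) [set r | r <= 0]); last exact: closed_le.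
          by move=> p _; exact: martin_coord_continuous.
        apply: accessible_closed_set1; apply: hausdorff_accessible.
        exact: martin_space_hausdorff.
      move=> y; case: (eqVneq x y) => [->|xy]; [by right|left].
      by rewrite [_ (_ _)]/= martin_inE /kernel_point /= (negPf xy).
    by case=> //; rewrite leNgt xp.
  apply: open_comp; last exact: open_gt.
  by move=> p _; exact: martin_coord_continuous.
- move=> O [p Op] oO; apply: contrapT => no.
  apply: (@martin_in_closed (~` O)) (Op) => [|y Oy]; first exact: open_closedC.
  by apply: no; exists (martin_in y); split=> //; exists y.
Qed.

(** On a competitor Y, the indicator of j x is continuous because j x is isolated
and closed; with the extended kernels it gives all the coordinates of a map to the
product, which lands in the closure by density. *)
Lemma martin0_model : martin0_compactification mu martin_in.
Proof.
split; first exact: martin_compactification.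
  move=> x; exists (fun p : martin_space => (set_val p : prodT) (x, false)) => //.
  exact: martin_coord_continuous.
move=> Y j j_cpt j_ext.
have h a : exists k : Y -> R, continuous k /\ forall y, k (j y) = kernel_point y a.
  case: a => x [] /=; last by have [k kc kE] := j_ext x; exists k.
  exists (fun q => (asbool (q = j x))%:R); split; last first.
    move=> y; rewrite /kernel_point /=; congr (_%:R); case: j_cpt => _ _ inj _ _.
    by congr nat_of_bool; apply/asboolP/eqP => [/inj ->|->].
  move=> q; have [->|qx] := pselect (q = j x).
    apply: (@cvg_near_cst _ _ _ _ (nbhs (j x))).
    apply: filterS (cpt_nbhs1 j_cpt x) => _ -> //.
  apply: (@cvg_near_cst _ _ _ _ (nbhs q)).
  have : nbhs q (~` [set j x]).
    by apply: open_nbhs_nbhs; split=> //; apply: closed_openC; exact: cpt_closed1 j_cpt _.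
  by apply: filterS => r rx; apply/eqP; rewrite /= !asboolF.
have [k hk] := choice h.
pose H (q : Y) : prodT := fun a => k a q.
have Hc : continuous H by apply: continuous_ptws => a; exact: (hk a).1.
have Hj y : H (j y) = kernel_point y by apply/funext => a; exact: (hk a).2.
have Hcl q : H q \in closure (range kernel_point).
  rewrite inE => B HB; have [y By] := cpt_meet j_cpt (Hc q B HB).
  by exists (H (j y)); split=> //; rewrite Hj; exists y.
exists (fun q => SigSub (Hcl q) : martin_space).
  by apply: (@continuous_comp_initial martin_space Y prodT set_val).
by move=> y; apply: val_inj; exact: Hj.
Qed.

End Model.

(** * A measure whose projection is not injective *)

Section ReducedWords.
Variable L : eqType.
Implicit Types (a b : L) (s t v : seq L).

Definition reduced s := sorted (fun a b => a != b) s.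

(** Left multiplication by the involution a in normal form. *)
Definition letter_act a s :=
  if s is b :: s' then if a == b then s' else a :: s else [:: a].

Definition word_mul s t := foldr letter_act t s.

(** The length of the longest common prefix, which is the Gromov product of the
normal forms based at the identity. *)
Fixpoint lcp s t : nat :=
  match s, t with
  | a :: s', b :: t' => if a == b then (lcp s' t').+1 else 0
  | _, _ => 0
  end.

Lemma reduced_cons a s : reduced (a :: s) = (ohead s != Some a) && reduced s.
Proof. by case: s => //= b s; congr (_ && _); rewrite eq_sym. Qed.

Lemma letter_act_cons a s : reduced (a :: s) -> letter_act a s = a :: s.
Proof. by case: s => //= b s /andP[/negPf ->]. Qed.

Lemma letter_act_reduced a s : reduced s -> reduced (letter_act a s).
Proof.
case: s => //= b s rs; case: eqVneq => [_|ab]; last by rewrite /= ab.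
exact: path_sorted rs.
Qed.

Lemma letter_actK a s : reduced s -> letter_act a (letter_act a s) = s.
Proof.
case: s => [_|b s rs] /=; first by rewrite eqxx.
by case: eqVneq => [->|ab]; [rewrite letter_act_cons | rewrite /= eqxx].
Qed.

Lemma word_mul_reduced s t : reduced t -> reduced (word_mul s t).
Proof. by move=> rt; elim: s => //= a s; exact: letter_act_reduced. Qed.

Lemma word_mul_act a s t : reduced t ->
  word_mul (letter_act a s) t = letter_act a (word_mul s t).
Proof.
move=> rt; case: s => //= b s; case: eqVneq => // ->.
by rewrite letter_actK// word_mul_reduced.
Qed.

Lemma word_mulA s t v : reduced v ->
  word_mul s (word_mul t v) = word_mul (word_mul s t) v.
Proof. by move=> rv; elim: s => //= a s ->; rewrite word_mul_act. Qed.

Lemma word_muls0 s : reduced s -> word_mul s [::] = s.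
Proof.
elim: s => //= a s IH rs; rewrite IH ?letter_act_cons//.
exact: path_sorted rs.
Qed.

Lemma reduced_rev s : reduced (rev s) = reduced s.
Proof. by rewrite /reduced rev_sorted; apply: eq_sorted => a b; rewrite eq_sym. Qed.

Lemma word_mul_rev_cons a s t :
  word_mul (rev (a :: s)) t = word_mul (rev s) (letter_act a t).
Proof. by rewrite /word_mul rev_cons foldr_rcons. Qed.

Lemma word_mul_revl s : word_mul (rev s) s = [::].
Proof. by elim: s => //= a s IH; rewrite word_mul_rev_cons /= eqxx. Qed.

Lemma size_word_mul_disjoint s t : reduced s -> reduced t -> lcp s t = 0 ->
  size (word_mul (rev s) t) = (size s + size t)%N.
Proof.
elim: s t => [|a s IH] t // ras rt l0.
have rat : reduced (a :: t).
  by case: t rt l0 => //= b t ->; case: eqVneq.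
rewrite word_mul_rev_cons letter_act_cons// IH//= ?addSnnS//.
  exact: path_sorted ras.
by case: s ras {IH l0} => //= b s /andP[/negPf]; rewrite eq_sym => ->.
Qed.

(** All cancellation in the product of s^-1 and t takes place in the common prefix. *)
Lemma size_word_mul s t : reduced s -> reduced t ->
  (size (word_mul (rev s) t) + (lcp s t).*2 = size s + size t)%N.
Proof.
elim: s t => [|a s IH] t ras rt; first by rewrite /= addn0.
have rs := path_sorted ras.
case: t rt => [|b t] rbt; first by rewrite size_word_mul_disjoint//= !addn0.
have rt := path_sorted rbt.
case: (eqVneq a b) => [ab|ab].
  by rewrite word_mul_rev_cons /= ab eqxx doubleS !addnS !addSn IH.
by rewrite /= (negPf ab) addn0 size_word_mul_disjoint//= (negPf ab).
Qed.

Lemma lcp_ultra s t v : (minn (lcp s t) (lcp t v) <= lcp s v)%N.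
Proof.
elim: s t v => [|a s IH] [|b t] [|c v] //=; rewrite ?minn0 ?min0n//.
case: (eqVneq a b) => [->|_]; last by rewrite min0n.
by case: (eqVneq b c) => [_|_]; [rewrite minnSS ltnS | rewrite minn0].
Qed.

End ReducedWords.

(** (Z/2 * Z/2 * Z/2) x Z/2 in normal form: a reduced word over three involutions
and an element of Z/2. The letter None is the involution r of the introduction,
and the two letters Some b are p and q. *)
Definition free3x2 := {p : seq (option bool) * bool | reduced p.1}.

HB.instance Definition _ := Choice.on free3x2.

Definition fword (x : free3x2) : seq (option bool) := (val x).1.
Definition fsign (x : free3x2) : bool := (val x).2.

Lemma fword_reduced x : reduced (fword x).
Proof. exact: valP x. Qed.

Definition mkfree s (rs : reduced s) (e : bool) : free3x2 :=
  exist (fun p : seq (option bool) * bool => reduced p.1) (s, e) rs.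

Lemma free3x2_eq x y : fword x = fword y -> fsign x = fsign y -> x = y.
Proof.
move=> ww ss; apply: val_inj; move: ww ss; rewrite /fword /fsign.
by case: (val x) (val y) => [s e] [t f] /= -> ->.
Qed.

Definition fmul x y : free3x2 :=
  mkfree (word_mul_reduced (fword x) (fword_reduced y)) (fsign x (+) fsign y).
Definition fone : free3x2 := @mkfree [::] isT false.
Definition finverse x : free3x2 :=
  mkfree (etrans (reduced_rev (fword x)) (fword_reduced x)) (fsign x).

Lemma fmulA : associative fmul.
Proof.
move=> x y z; apply: free3x2_eq; last exact: addbA.
by apply: word_mulA; exact: fword_reduced.
Qed.

Lemma fmul1 : left_id fone fmul.
Proof. by move=> x; apply: free3x2_eq. Qed.

Lemma fmulr1 : right_id fone fmul.
Proof.
move=> x; apply: free3x2_eq; last exact: addbF.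
by apply: word_muls0; exact: fword_reduced.
Qed.

Lemma fmulV : left_inverse fone finverse fmul.
Proof. by move=> x; apply: free3x2_eq; [exact: word_mul_revl | exact: addbb]. Qed.

Lemma fmulrV : right_inverse fone finverse fmul.
Proof.
move=> x; apply: free3x2_eq; last exact: addbb.
rewrite -[LHS]/(word_mul (fword x) (rev (fword x))) -{1}(revK (fword x)).
exact: word_mul_revl.
Qed.

HB.instance Definition _ := isGroup.Build free3x2 fmulA fmul1 fmulr1 fmulV fmulrV.

Lemma fwordM (x y : free3x2) : fword (x * y)%g = word_mul (fword x) (fword y).
Proof. by []. Qed.

Lemma fsignM (x y : free3x2) : fsign (x * y)%g = fsign x (+) fsign y.
Proof. by []. Qed.

Lemma fwordV (x : free3x2) : fword x^-1%g = rev (fword x).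
Proof. by []. Qed.

Lemma reduced1 (a : option bool) : reduced [:: a].
Proof. by []. Qed.

Definition fletter (a : option bool) : free3x2 := mkfree (reduced1 a) false.
(** The element rt: t itself is not a generator, it has to be bought with r. *)
Definition ftwist : free3x2 := mkfree (reduced1 None) true.

Definition fgens : seq free3x2 :=
  [:: fletter (Some true); fletter (Some false); fletter None; ftwist].

Lemma fgensP z : z \in fgens -> (exists a, z = fletter a) \/ z = ftwist.
Proof.
rewrite !inE => /or4P[] /eqP ->; [left|left|left|by right];
  by [exists (Some true)|exists (Some false)|exists None].
Qed.

Lemma fletter_in a : fletter a \in fgens.
Proof. by case: a => [[]|]; rewrite !inE eqxx ?orbT. Qed.

Lemma ftwist_in : ftwist \in fgens.
Proof. by rewrite !inE eqxx !orbT. Qed.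

Lemma fgensV z : z \in fgens -> z^-1%g = z.
Proof. by move=> /fgensP[[a ->]|->]; apply: free3x2_eq. Qed.

Lemma fgens_uniq : uniq fgens.
Proof. by []. Qed.

(** A lower bound for the norm. A word that contains r can acquire t at no cost by
replacing r with rt; otherwise t costs the two letters r and rt. *)
Definition fweight (x : free3x2) : nat :=
  (size (fword x) + if None \in fword x then 0 else (fsign x).*2)%N.

Lemma fweight_act (x : free3x2) z : z \in fgens -> (fweight (z * x)%g <= (fweight x).+1)%N.
Proof.
move=> zg; rewrite /fweight fwordM fsignM.
have {zg} : (exists2 b : bool, fword z = [:: Some b] & fsign z = false) \/ fword z = [:: None].
  case/fgensP: zg => [[[b|] ->]|->]; [left; by exists b| by right | by right].
have := fword_reduced x.
case: (fword x) => [|a s] ras [[b -> ->]|->].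
- by rewrite /=; case: (fsign x).
- by rewrite /=; case: (fsign z (+) fsign x).
- rewrite /=; case: eqVneq => [<-|_]; rewrite !inE /=; case: ifP => _; lia.
- rewrite /=; case: eqVneq => [<-|_]; rewrite !inE /=; case: ifP => _; case: (fsign x); case: (fsign z) => /=; lia.
Qed.

Lemma fweight_prod s : (forall z, z \in s -> z \in fgens) ->
  (fweight (\prod_(z <- s) z)%g <= size s)%N.
Proof.
elim: s => [|z s IH] hs; first by rewrite big_nil.
rewrite big_cons (leq_trans (fweight_act _ _)) ?hs ?mem_head// ltnS IH// => t ts.
by rewrite hs// inE ts orbT.
Qed.

Lemma prod_fletter s (rs : reduced s) :
  (\prod_(z <- [seq fletter a | a <- s]) z)%g = mkfree rs false.
Proof.
elim: s rs => [|a s IH] rs; first by rewrite big_nil; apply: free3x2_eq.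
rewrite big_cons (IH (path_sorted rs)); apply: free3x2_eq => //.
by rewrite fwordM; exact: letter_act_cons.
Qed.

(** The word spelling the reduced word of x is completed by r rt = t or r r = e; the
second choice is there only to keep it nonempty. *)
Lemma fword_gen x : exists2 s : seq free3x2,
  [/\ s != [::], forall z, z \in s -> z \in fgens & (\prod_(z <- s) z)%g = x] &
  (size s <= size (fword x) + 2)%N.
Proof.
pose t := if fsign x then [:: fletter None; ftwist] else [:: fletter None; fletter None].
exists ([seq fletter a | a <- fword x] ++ t); last first.
  by rewrite size_cat size_map leq_add2l /t; case: ifP.
split.
- by rewrite -size_eq0 size_cat /t; case: ifP => _; rewrite addn2.
- move=> z; rewrite mem_cat => /orP[/mapP[a _ ->]|]; first exact: fletter_in.
  by rewrite /t; case: ifP => _; rewrite !inE => /orP[] /eqP ->; rewrite eqxx ?orbT.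
- rewrite big_cat prod_fletter ?fword_reduced// => rx /=.
  have -> : (\prod_(z <- t) z)%g = mkfree (isT : reduced [::]) (fsign x).
    by rewrite /t; case: ifP => _; rewrite !big_cons big_nil; apply: free3x2_eq.
  by apply: free3x2_eq => //; rewrite fwordM /=; apply: word_muls0; exact: fword_reduced.
Qed.

Lemma fgens_set_finite : finite_set [set z | z \in fgens].
Proof. exact: finite_seq. Qed.

Lemma fgens_set_gen x : exists2 s : seq free3x2,
  word_in [set z | z \in fgens] s & (\prod_(z <- s) z)%g = x.
Proof.
have [s [_ sg sE] _] := fword_gen x; exists s => // z /sg zg; by left.
Qed.

Definition fgenset : genset free3x2 := Genset fgens_set_finite fgens_set_gen.

Local Notation flen := (word_len fgenset).

Lemma flen_bounds x : (size (fword x) <= flen x <= size (fword x) + 2)%N.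
Proof.
apply/andP; split; last first.
  have [s [_ sg <-] ss] := fword_gen x; apply: leq_trans ss.
  by apply: word_len_le => z /sg zg; left.
have [s [<- sS sE]] := word_lenP fgenset x.
have sg z : z \in s -> z \in fgens.
  by move=> /sS [//|/= zg]; rewrite -(invgK z) fgensV.
by have := fweight_prod sg; rewrite sE /fweight; apply: leq_trans; rewrite leq_addr.
Qed.

Definition flcp (x y : free3x2) : nat := lcp (fword x) (fword y).

(** In the norm of the example each of the three lengths of the Gromov product is
within 2 of the length of the reduced word. *)
Lemma gprod_flcp x y :
  (flcp x y)%:R - 1 <= gprod fgenset 1%g x y <= (flcp x y)%:R + 2%:R.
Proof.
have := size_word_mul (fword_reduced x) (fword_reduced y).
have /andP[] := flen_bounds x; have /andP[] := flen_bounds y.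
have /andP[] := flen_bounds (x^-1 * y)%g.
rewrite fwordM fwordV -/(flcp x y) /gprod !word_dist1 /word_dist.
rewrite -!(ler_nat rat) !natrD => h1 h2 h3 h4 h5 h6 /(congr1 (fun n => n%:R : rat)).
rewrite -addnn !natrD => h7; apply/andP; split; lra.
Qed.

Lemma fgenset_hyperbolic : hyperbolic fgenset.
Proof.
(* the product exceeds the longest common prefix by at least -1 and at most 2 *)
exists 3%:R => w x y z.
have E u v : gprod fgenset w u v = gprod fgenset 1%g (w^-1 * u)%g (w^-1 * v)%g.
  by rewrite /gprod /word_dist !invg1 !mul1g invgM invgK -mulgA mulVKg.
rewrite !E; move: (_ * x)%g (_ * y)%g (_ * z)%g => {}x {}y {}z.
have /andP[_ h1] := gprod_flcp x y; have /andP[_ h2] := gprod_flcp y z.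
have /andP[h3 _] := gprod_flcp x z.
have := lcp_ultra (fword x) (fword y) (fword z); rewrite -!/(flcp _ _) geq_min.
rewrite -!(ler_nat rat) => /orP[] h4.
  have : Num.min (gprod fgenset 1%g x y) (gprod fgenset 1%g y z) <= gprod fgenset 1%g x y.
    by rewrite ge_min lexx.
  lra.
have : Num.min (gprod fgenset 1%g x y) (gprod fgenset 1%g y z) <= gprod fgenset 1%g y z.
  by rewrite ge_min lexx orbT.
lra.
Qed.

Fixpoint alternating (b : bool) n : seq (option bool) :=
  if n is m.+1 then Some b :: alternating (~~ b) m else [::].

Lemma size_alternating b n : size (alternating b n) = n.
Proof. by elim: n b => //= n IH b; rewrite IH. Qed.

Lemma alternating_notin b n : None \notin alternating b n.
Proof. by elim: n b => //= n IH b; rewrite inE negb_or IH. Qed.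

Lemma alternating_reduced b n : reduced (None :: alternating b n).
Proof.
rewrite reduced_cons; apply/andP; split; first by case: n.
elim: n b => // n IH b; rewrite [alternating _ _]/= reduced_cons IH andbT.
by case: n {IH} => //= _; case: b.
Qed.

Lemma lcp_alternating b n m : lcp (alternating b n) (alternating b m) = minn n m.
Proof.
elim: n m b => [|n IH] [|m] b //=; rewrite ?minn0//.
by rewrite eqxx IH minnSS.
Qed.

(** The elements r p q p ... and r p q p ... t, which converge to the same point of
the Gromov boundary. *)
Definition fray (e : bool) (n : nat) : free3x2 := mkfree (alternating_reduced true n) e.

Lemma fray_equiv e e' : gromov_equiv fgenset (fray e) (fray e').
Proof.
move=> r; exists (Num.bound `|r|) => n m hn hm.
have /andP[h _] := gprod_flcp (fray e n) (fray e' m).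
apply: le_trans h; rewrite /flcp /= lcp_alternating.
have h : (Num.bound `|r| <= minn n m)%N by rewrite leq_min hn.
have : (Num.bound `|r|)%:R <= (minn n m)%:R :> rat by rewrite ler_nat.
have := archi_boundP (normr_ge0 r); have := ler_norm r.
rewrite -[(minn n m).+1]addn1 natrD; lra.
Qed.

Section ExampleMeasure.
Variable R : realType.

Definition fmu (x : free3x2) : R := if x \in fgens then 4%:R^-1 else 0.

Lemma msupp_fmu : msupp fmu = [set z | z \in fgens].
Proof.
apply/seteqP; split=> z; rewrite /msupp /= /fmu; case: ifP => //.
by rewrite ltxx.
Qed.

Lemma fmu_fin : finite_set (msupp fmu).
Proof. by rewrite msupp_fmu; exact: finite_seq. Qed.

Lemma fmu_prob : prob_measure fmu.
Proof.
split=> [x|]; first by rewrite /fmu; case: ifP => //; rewrite invr_ge0.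
rewrite -(@fsbig_widen _ _ _ _ [set z | z \in fgens])//; last first.
  by move=> z [_ /= /negP]; rewrite /fmu => /negPf ->.
rewrite -fsbig_seq ?fgens_uniq// big_seq.
under eq_bigr => z zg do rewrite /fmu zg.
rewrite -big_seq big_const_seq /= /fgens /= addr0; lra.
Qed.

Lemma fmu_gt0 z : z \in fgens -> 0 < fmu z.
Proof. by rewrite /fmu => ->; rewrite invr_gt0. Qed.

Lemma fmu_adm : admissible fmu.
Proof.
move=> x; have [s [s0 sg sE] _] := fword_gen x; exists s; split=> // z /sg.
exact: fmu_gt0.
Qed.

Lemma fmu_sym : symmetric_measure fmu.
Proof.
move=> x; rewrite /fmu; have -> // : (x^-1%g \in fgens) = (x \in fgens).
by apply/idP/idP => xg; [rewrite -(invgK x)|]; rewrite fgensV.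
Qed.

Lemma fweight_mu_len x : (fweight x <= mu_len fmu x)%N.
Proof.
have [s [<- s0 <-]] := conv_pow_gt0P fmu_prob fmu_fin (mu_lenP fmu_prob fmu_fin fmu_adm x).
apply: fweight_prod => z /s0; rewrite /fmu; case: ifP => //.
by rewrite ltxx.
Qed.

Definition fstart e := if e then ftwist else fletter None.

Lemma mu_len_fray e n : (mu_len fmu (fray e n) <= n.+1)%N.
Proof.
have ra : reduced (alternating true n) by exact: path_sorted (alternating_reduced true n).
have E : (\prod_(z <- fstart e :: [seq fletter a | a <- alternating true n]) z)%g = fray e n.
  rewrite big_cons (prod_fletter ra); apply: free3x2_eq; last by rewrite fsignM; case: e.
  by rewrite fwordM /fstart; case: e; exact: (letter_act_cons (alternating_reduced true n)).
have sz : size (fstart e :: [seq fletter a | a <- alternating true n]) = n.+1.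
  by rewrite /= size_map size_alternating.
rewrite -sz -E; apply: mu_len_le.
apply: (conv_pow_prod_gt0 fmu_prob fmu_fin) => z.
rewrite inE => /orP[/eqP ->|/mapP[a _ ->]]; apply: fmu_gt0; last exact: fletter_in.
by rewrite /fstart; case: e {E sz}; [exact: ftwist_in | exact: fletter_in].
Qed.

(** After any other first step x, the weight of what remains exceeds n: for p or q
nothing has been cancelled, and for the wrong choice among r and rt the rest contains
no r but has the wrong sign, which costs 2. *)
Lemma fray_first_step e n x : mu_len fmu x = 1%N ->
  mu_len fmu (fray e n) = (mu_len fmu x + mu_len fmu (x^-1 * fray e n)%g)%N ->
  x = fstart e.
Proof.
move=> x1; rewrite x1 => yx.
have xg : x \in fgens.
  have := mu_lenP fmu_prob fmu_fin fmu_adm x.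
  rewrite x1 (conv_pow1 fmu_prob fmu_fin) /fmu; case: ifP => //.
  by rewrite ltxx.
have : (fweight (x * fray e n)%g <= n)%N.
  apply: leq_trans (fweight_mu_len _) _.
  by have := mu_len_fray e n; rewrite yx (fgensV xg) add1n ltnS.
have na := alternating_notin true n.
case/fgensP: xg => [[[b|] ->]|->]; rewrite /fweight fwordM fsignM /=.
- by rewrite ?inE /= size_alternating; lia.
- by rewrite (negPf na) size_alternating /=; case: e {yx} => //=; lia.
- by rewrite (negPf na) size_alternating /=; case: e {yx} => //=; lia.
Qed.

(** Cluster points of the two sequences have the same image. If they were equal, an
element x of norm 1 preceding them would be the first step of geodesics to elements of
both sequences, whereas these steps are r and rt respectively. *)
Lemma fray_not_injective (X : topologicalType) (i : free3x2 -> X)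
    (f : X -> gromov_cpt fgenset) :
  compactification i -> martin0_extends fmu i ->
  (forall u p, gromov_seq fgenset u -> seq_cluster i u p ->
      exists2 c, f p = GBd c & sval c = bdry_class fgenset u) ->
  ~ injective f.
Proof.
move=> i_cpt i_ext f_lim f_inj.
have gseq e : gromov_seq fgenset (fray e) by exact: fray_equiv.
have [p pl] := seq_cluster_ex i_cpt (fray false).
have [q ql] := seq_cluster_ex i_cpt (fray true).
have pq : p = q.
  have [c fp cE] := f_lim _ _ (gseq false) pl.
  have [c' fq c'E] := f_lim _ _ (gseq true) ql.
  apply: f_inj; rewrite fp fq; apply: GBd_inj_sval; rewrite cE c'E.
  have [delta hyp] := fgenset_hyperbolic.
  by apply: (bdry_class_eq hyp); exact: fray_equiv.
have pG := seq_cluster_notin i_cpt (gseq false) pl.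
have [x x1 xp] := precedes_ex fmu_prob fmu_fin fmu_adm i_cpt i_ext 1 pG.
have xn : nbhs p (precedes fmu i x) by apply: open_nbhs_nbhs; split=> //; exact: open_precedes.
have [n _ /precedes_aligned xn0] := pl _ xn 0%N.
have [m _ /precedes_aligned xm1] := ql _ (eq_ind _ (fun t => nbhs t _) xn _ pq) 0%N.
have : fstart false = fstart true.
  by rewrite -(fray_first_step x1 xn0) -(fray_first_step x1 xm1).
by [].
Qed.

End ExampleMeasure.

Theorem theorem5p1 (R : realType) :
  (forall (G : groupType) (S : genset G) (mu : G -> R),
     hyperbolic S ->
     prob_measure mu -> finite_set (msupp mu) -> admissible mu ->
     symmetric_measure mu ->
     (exists (X : topologicalType) (i : G -> X), martin0_compactification mu i) /\
     (forall (X : topologicalType) (i : G -> X),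
        martin0_compactification mu i ->
        exists f : X -> gromov_cpt S, gromov_projection i f)) /\
  (exists (G : groupType) (S : genset G) (mu : G -> R),
     [/\ hyperbolic S, prob_measure mu, finite_set (msupp mu), admissible mu &
         symmetric_measure mu] /\
     exists (X : topologicalType) (i : G -> X),
       martin0_compactification mu i /\
       exists2 f : X -> gromov_cpt S, gromov_projection i f & ~ injective f).
Proof.
split=> [G S mu hypS mu_prob mu_fin mu_adm _|].
  split; first by exists (martin_space mu), (@martin_in R G mu); exact: martin0_model.
  move=> X i [i_cpt i_ext _].
  by have [f hf _] := projection_ex hypS mu_prob mu_fin mu_adm i_cpt i_ext; exists f.
exists free3x2, fgenset, (@fmu R); split.
  split; [exact: fgenset_hyperbolic | exact: fmu_prob | exact: fmu_fin |
    exact: fmu_adm | exact: fmu_sym].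
exists (martin_space (@fmu R)), (@martin_in R free3x2 (@fmu R)).
have model := martin0_model (@fmu_prob R) (@fmu_fin R) (@fmu_adm R).
split=> //; have [i_cpt i_ext _] := model.
have [f hf f_lim] := projection_ex fgenset_hyperbolic
  (@fmu_prob R) (@fmu_fin R) (@fmu_adm R) i_cpt i_ext.
by exists f => //; exact: (fray_not_injective i_cpt i_ext f_lim).
Qed.
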